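(* Let $p$ be a prime and let $A$ be a multiplicative subgroup of $\mathbb Z_p^*$ such that $|A|\ll p^{\frac 23}$. Then \begin{equation*}|2A|\gg \begin{cases} |A|^{\frac 85}\log^{-\frac 3{10}}(|A|), &\text{if } |A|\ll p^{\frac 59}\log^{-\frac 1{18}}(|A|); \\ |A|p^{\frac 13} \log^{-\frac 1{3}}(|A|), &\text{if } |A|\gg p^{\frac 59}\log^{-\frac 1{18}}(|A|). \end{cases} \end{equation*}
   Context: $2A=\{x+y:x,y\in A\}$. The notation $X\ll Y$ (equivalently $Y\gg X$) means $X\le CY$ for an absolute constant $C>0$. *)

(* Defs.v *)
From HB Require Import structures.
From mathcomp Require Import all_boot all_order all_algebra all_fingroup.
From mathcomp Require Import all_classical all_reals all_analysis.

Set Implicit Arguments.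
Unset Strict Implicit.
Unset Printing Implicit Defensive.

Import GRing.Theory.
Local Open Scope ring_scope.

(* For p prime, 'F_p is Z/pZ and {unit 'F_p} is the group (Z/pZ)^*; residues
   forgets the unit structure so that elements of A can be added. *)
Definition residues (p : nat) (A : {set {unit 'F_p}}) : {set 'F_p} :=
  [set val u | u in A]%SET.

Definition sumset2 (V : finZmodType) (B : {set V}) : {set V} :=
  [set x + y | x in B, y in B]%SET.

(* X << Y with implied constant C. *)
Definition ll_with (R : realType) (C X Y : R) : Prop := X <= C * Y.

(* Main.v *)
Require Import Defs.
From HB Require Import structures.
From mathcomp Require Import all_boot all_order all_algebra all_fingroup.
From mathcomp Require Import all_classical all_reals all_analysis.
From mathcomp Require Import cyclic zify ring lra.

(** Write [t = |A|] and [S = A + A], so that [A] is the set of roots of [x ^ t = 1] and the cosets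
    of [A] are told apart by [t]-th powers ("keys"); let [m ~ |S| / t] be the number of keys of [S].

    Stepanov's method bounds the number of [u] such that the keys of [u] and [u - 1] form a pair in
    a given set [W] by [O(t^2 / d^2 + |W| d)], for every [d] at least [d0 ~ max (1, t^2 / p)]; the
    optimal [d] gives [(t |W|)^(2/3)].  Hence [O(t^2 / h^3)] pairs of keys carry [h] or more points.

    Cauchy-Schwarz gives [t^4 <= |S| E] with [E] the additive energy, the sum of the squares of the
    numbers [r x] of representations of [x] as a difference in [A].  For a set [P] of [k] keys send
    the triples [(a, (b, c))] with the key of [b - c] in [P] to the slope [(a + b) / (b - c)].  Its
    values [u] have the pairs of keys of [u] and [u - 1] in a set of at most [m^2 k] pairs, so
    Stepanov bounds the image; and the collisions amount to solutions of
    [a - nu a' = - (b - nu b') = - (c - nu c')], whose number, over all [nu], is [O(t^4 log t)] up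
    to a contribution of the sparsely represented differences that is absorbed on the left.
    Working with slopes rather than with the pairs [(a + b, a + c)] counts each pair of keys once
    even when [S] is nearly invariant under many dilations.

    Sorting the keys by [r] and cutting them in blocks of a common size, the first block is handled
    by the pointwise bound on [r] and the other ones by the preceding inequality.  The outcome is
    [t^2 = O(m t + m^3 (m^(1/3) + t^2 / p) log t)], which contains both cases of the theorem. *)

Set Implicit Arguments.
Unset Strict Implicit.
Unset Printing Implicit Defensive.

Import Order.TTheory GRing.Theory Num.Theory.
Import mathcomp.boot.fintype mathcomp.boot.finset.
Local Open Scope ring_scope.

(** * Sparse polynomials and their order of vanishing at 1 in characteristic [p] *)

Section SparsePolynomials.
Variables (F : fieldType) (p : nat).
Hypothesis charFp : p \in [pchar F].

Definition nterms (n : nat) (f : {poly F}) : nat :=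
  (\sum_(i < n) (f`_i != 0)%R)%N.

Lemma ntermsD n (f g : {poly F}) : (nterms n (f + g) <= nterms n f + nterms n g)%N.
Proof.
rewrite /nterms -big_split /=; apply: leq_sum => i _.
by rewrite coefD; case: (f`_i =P 0) => [->|_]; rewrite ?add0r //; case: (_ != 0).
Qed.

Lemma nterms_sum n (I : finType) (f : I -> {poly F}) :
  (nterms n (\sum_i f i)%R <= \sum_i nterms n (f i))%N.
Proof.
elim/big_rec2: _ => [|i x g _ le_gx]; last first.
  by apply: leq_trans (ntermsD _ _ _) _; rewrite leq_add2l.
by rewrite /nterms big1 // => i _; rewrite coef0 eqxx.
Qed.

Lemma nterms_scaleXn n (c : F) k : (nterms n (c *: 'X^k) <= 1)%N.
Proof.
rewrite /nterms; have [ltkn|lenk] := ltnP k n.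
  rewrite (bigD1 (Ordinal ltkn)) //= big1 ?addn0; first by case: (_ != 0).
  move=> i neq_ik; rewrite coefZ coefXn; case: (val i =P k) => [eq_ik|_]; last by rewrite mulr0 eqxx.
  by case/eqP: neq_ik; apply: val_inj.
rewrite big1 // => i _; rewrite coefZ coefXn; case: (val i =P k) => [eq_ik|_]; last by rewrite mulr0 eqxx.
by move: (ltn_ord i); rewrite eq_ik ltnNge lenk.
Qed.

Lemma natf_pchar_neq0 k : (0 < k < p)%N -> k%:R != 0 :> F.
Proof.
by move=> /andP[k_gt0 ltkp]; rewrite -(dvdn_pcharf charFp) gtnNdvd.
Qed.

(* Differentiation kills the constant term, so each factor of ['X - 1] costs a term. *)
Lemma sparse_not_dvd n k (f : {poly F}) :
  (n <= p)%N -> (size f <= n)%N -> f != 0 -> (nterms n f <= k)%N ->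
  ~~ (('X - 1%:P) ^+ k %| f)%R.
Proof.
elim: n k f => [|n IHn] k f lenp; first by rewrite leqn0 size_poly_eq0 => ->.
move=> sz_f f_neq0; rewrite /nterms big_ord_recl /=.
have [f0|f0] := eqVneq f`_0 0.
  rewrite add0n => le_nt.
  have [g def_f] : exists g, f = g * 'X.
    suff /factor_theorem[g ->] : root f 0 by exists g; rewrite subr0.
    by rewrite /root horner_coef0 f0.
  have g_neq0 : g != 0 by apply: contraNneq f_neq0 => g0; rewrite def_f g0 mul0r.
  have sz_g : (size g <= n)%N by move: sz_f; rewrite def_f size_mulX.
  have := IHn k g (ltnW lenp) sz_g g_neq0; rewrite def_f Gauss_dvdpl; last first.
    by apply: coprimep_expl; rewrite coprimepX root_XsubC eq_sym oner_eq0.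
  apply; apply: leq_trans le_nt; apply: leq_sum => i _.
  by rewrite def_f coefMX.
rewrite add1n; case: k => [|k] //; rewrite ltnS => le_nt.
apply/negP => dvd_f.
have dvd_f' : (('X - 1%:P) ^+ k %| f^`())%R.
  case/dvdpP: dvd_f => g ->; rewrite derivM deriv_exp derivXsubC mul1r /=.
  rewrite -mulr_natr exprSr dvdp_add //; first by rewrite dvdp_mull // dvdp_mulr.
  by rewrite dvdp_mull // dvdp_mulr.
have [f'0|f'_neq0] := eqVneq f^`() 0.
  (* Since [f] has degree below [p], a zero derivative leaves only the constant term, and a nonzero
     constant has no root at 1. *)
  suff sz1 : (size f <= 1)%N.
    have := dvdp_leq f_neq0 dvd_f; rewrite size_exp_XsubC => /leq_trans/(_ sz1).
    by [].
  apply/leq_sizeP => -[//|j] _; have [lejn|ltnj] := leqP n j.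
    by apply/eqP; move/leq_sizeP: sz_f => ->.
  have /polyP/(_ j) := f'0; rewrite coef_deriv coef0 -mulr_natr => /eqP.
  by rewrite mulf_eq0 (negPf (natf_pchar_neq0 _)) ?orbF; [move/eqP | lia].
have sz_f' : (size f^`() <= n)%N.
  by rewrite -ltnS (leq_trans (lt_size_deriv f_neq0)).
have := IHn k _ (ltnW lenp) sz_f' f'_neq0; rewrite dvd_f' => /(_ _)/negP; apply=> //.
apply: leq_trans le_nt; apply: leq_sum => i _; rewrite coef_deriv -mulr_natr mulf_eq0 negb_or.
by rewrite /bump add1n; case: (f`_i.+1 == 0) => //=; case: (_ != 0).
Qed.

End SparsePolynomials.

(** Pigeonhole over a finite field: the map [l -> l M] cannot be injective for cardinality reasons,
    and the difference of two vectors with the same image is the solution. *)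
Lemma linear_system_nontrivial (F : finFieldType) (I J : finType) (M : I -> J -> F) :
  (#|J| < #|I|)%N ->
  exists2 l : I -> F, (exists i, l i != 0) & forall j, \sum_i l i * M i j = 0.
Proof.
move=> ltJI; pose f (l : {ffun I -> F}) := [ffun j => \sum_i l i * M i j].
have : ~~ injectiveb f.
  apply/injectiveP => /leq_card; rewrite !card_ffun.
  by rewrite leq_exp2l ?card_finNzRing_gt1 // leqNgt ltJI.
case/injectivePn => l [l' neq_ll eq_f].
exists (fun i => l i - l' i).
  apply/existsP; apply: contraNT neq_ll; rewrite negb_exists => /forallP eq_l.
  by apply/eqP/ffunP => i; apply/eqP; rewrite -subr_eq0; have := eq_l i; rewrite negbK.
move=> j; have /ffunP/(_ j) := eq_f; rewrite !ffunE => eq_j.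
by under eq_bigr do rewrite mulrBl; rewrite sumrB eq_j subrr.
Qed.

Lemma prod_XsubC_exp_dvd (F : fieldType) (d : nat) (f : {poly F}) (s : seq F) :
  uniq s -> {in s, forall u, (('X - u%:P) ^+ d %| f)%R} ->
  (\prod_(u <- s) ('X - u%:P) ^+ d %| f)%R.
Proof.
elim: s => [|u s IHs] /=; first by rewrite big_nil dvd1p.
move=> /andP[u_notin uniq_s] dvd_s; rewrite big_cons Gauss_dvdp.
  rewrite dvd_s ?mem_head //= IHs // => v v_s; apply: dvd_s.
  by rewrite inE v_s orbT.
rewrite big_seq; elim/big_rec: _ => [|v g v_s co_g]; first exact: coprimep1.
rewrite coprimepMr co_g andbT; apply/coprimep_expl/coprimep_expr.
rewrite coprimep_XsubC root_XsubC; apply: contraNneq u_notin => <-//.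
Qed.

(** * An Euler-type derivation adapted to the points 0 and 1 *)

Section EulerOperator.
Variable F : fieldType.
Implicit Types (f g Q : {poly F}) (u : F).

(** The factor [X (X - 1)] keeps the powers of [X] and [X - 1] in a product intact, so that only the
    cofactor [Q] changes, by [twist], and its size grows by at most one. Away from 0 and 1 the
    operator still detects multiplicities as the derivative does. *)
Definition theta f : {poly F} := 'X * ('X - 1%:P) * f^`().

Definition twist (i j : nat) Q : {poly F} :=
  'X * ('X - 1%:P) * Q^`() + (i%:R *: ('X - 1%:P) + j%:R *: 'X) * Q.

Lemma theta_twist i j Q :
  theta (Q * 'X^i * ('X - 1%:P) ^+ j) = twist i j Q * 'X^i * ('X - 1%:P) ^+ j.
Proof.
rewrite /theta /twist !derivM derivXn deriv_exp derivXsubC mul1r -!mul_polyC.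
rewrite !polyC_natr -[_ *+ i](mulr_natr _ i) -[_ *+ j in LHS](mulr_natr _ j).
have X_pred k (Y : {poly F}) : Y * (Y ^+ k.-1 * k%:R) = Y ^+ k * k%:R.
  by case: k => [|k]; rewrite ?mulr0 // mulrA -exprS.
transitivity ('X * ('X - 1%:P) * Q^`() * 'X^i * ('X - 1%:P) ^+ j
   + ('X - 1%:P) * Q * ('X * ('X^(i.-1) * i%:R)) * ('X - 1%:P) ^+ j
   + 'X * Q * 'X^i * (('X - 1%:P) * (('X - 1%:P) ^+ j.-1 * j%:R))); last first.
  rewrite !X_pred; move: ('X) ('X - 1%:P) => X Y; move: (X ^+ i) (Y ^+ j) (Q^`()) => Xi Yj Q'.
  by ring.
move: ('X) ('X - 1%:P) => X Y.
move: (X ^+ i) (Y ^+ j) (X ^+ i.-1) (Y ^+ j.-1) (Q^`()) => Xi Yj Xi' Yj' Q'.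
by ring.
Qed.

Lemma iter_theta_twist r i j Q :
  iter r theta (Q * 'X^i * ('X - 1%:P) ^+ j)
  = iter r (twist i j) Q * 'X^i * ('X - 1%:P) ^+ j.
Proof. by elim: r => //= r ->; rewrite theta_twist. Qed.

Lemma theta_is_linear : linear theta.
Proof.
by move=> c f g; rewrite /theta derivD derivZ mulrDr -scalerAr.
Qed.

HB.instance Definition _ :=
  GRing.isLinear.Build F {poly F} {poly F} _ theta theta_is_linear.

Lemma iter_theta_sum r (I : finType) (f : I -> {poly F}) (c : I -> F) :
  iter r theta (\sum_i c i *: f i) = \sum_i c i *: iter r theta (f i).
Proof.
elim: r => //= r ->; rewrite linear_sum /=.
by apply: eq_bigr => i _; rewrite linearZ.
Qed.

Lemma size_twist i j Q k : (size Q <= k)%N -> (size (twist i j Q) <= k.+1)%N.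
Proof.
move=> sz_Q; rewrite /twist (leq_trans (size_polyD _ _)) // geq_max.
have szX : (size ('X : {poly F}) <= 2)%N by rewrite size_polyX.
have szX1 : (size ('X - 1%:P : {poly F})%R <= 2)%N by rewrite size_XsubC.
apply/andP; split; last first.
  apply: leq_trans (size_polyMleq _ _) _.
  suff szl : (size (i%:R *: ('X - 1%:P) + j%:R *: 'X : {poly F})%R <= 2)%N by lia.
  rewrite (leq_trans (size_polyD _ _)) // geq_max.
  by rewrite !(leq_trans (size_scale_leq _ _)).
have [->|Q_neq0] := eqVneq Q 0; first by rewrite deriv0 mulr0 size_poly0.
have := lt_size_deriv Q_neq0.
have le3 : (size ('X * ('X - 1%:P) : {poly F})%R <= 3)%N.
  by apply: leq_trans (size_polyMleq _ _) _; rewrite size_polyX size_XsubC.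
move=> ltQ; apply: leq_trans (size_polyMleq _ _) _.
move: (leq_add le3 (leq_trans ltQ sz_Q)); rewrite addnS.
by case: (_ + size _)%N => //= n; lia.
Qed.

Lemma size_iter_twist r i j Q k :
  (size Q <= k)%N -> (size (iter r (twist i j) Q) <= k + r)%N.
Proof.
by move=> sz_Q; elim: r => [|r IHr]; rewrite ?addn0 //= addnS size_twist.
Qed.

Variable p : nat.
Hypothesis charFp : p \in [pchar F].

(** Each application lowers the multiplicity at [u] by exactly one: it multiplies the value of the
    cofactor at [u] by [u (u - 1)] and by the current multiplicity, which is nonzero in [F] because
    [e < p]. *)
Lemma iter_theta_neq0 e g u : (e < p)%N -> u != 0 -> u != 1 -> ~~ root g u ->
  ~~ root (iter e theta (g * ('X - u%:P) ^+ e)) u.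
Proof.
move=> + u0 u1; elim: e g => [|e IHe] g lt_ep g_u; first by rewrite /= expr0 mulr1.
pose g' := 'X * ('X - 1%:P) * (e.+1%:R *: g + ('X - u%:P) * g^`()).
rewrite iterSr; have -> : theta (g * ('X - u%:P) ^+ e.+1) = g' * ('X - u%:P) ^+ e.
  rewrite /theta /g' derivM deriv_exp derivXsubC mul1r -mul_polyC polyC_natr.
  rewrite -mulr_natr exprS /=; move: (g^`()) (_ ^+ e) => Dg V; by ring.
apply: IHe (ltnW lt_ep) _; rewrite /root /g' !hornerE subrr mul0r addr0.
by rewrite !mulf_neq0 // ?subr_eq0 // (natf_pchar_neq0 charFp).
Qed.

Lemma iter_theta_root_dvd d f u : (d <= p)%N -> u != 0 -> u != 1 ->
  (forall r, (r < d)%N -> root (iter r theta f) u) -> (('X - u%:P) ^+ d %| f)%R.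
Proof.
move=> le_dp u0 u1 rt_f; have [->|f_neq0] := eqVneq f 0; first exact: dvdp0.
have [e [g]] := multiplicity_XsubC f u; rewrite f_neq0 /= => g_u def_f.
have [le_de|lt_ed] := leqP d e.
  by rewrite def_f dvdp_mull // dvdp_exp2l.
have := iter_theta_neq0 (leq_trans lt_ed le_dp) u0 u1 g_u.
by rewrite -def_f rt_f.
Qed.

End EulerOperator.

(** Uniqueness of an expansion in powers of [Y] whose nonzero digits are not divisible by [Y]: the
    lowest digit is divisible by [Y], hence zero, and [Y] cancels from the rest. *)
Lemma adic_expansion_eq0 (F : fieldType) (Y : {poly F}) n (f : 'I_n -> {poly F}) :
  Y != 0 -> (forall c, (Y %| f c)%R -> f c = 0) ->
  \sum_(c < n) f c * Y ^+ c = 0 -> forall c, f c = 0.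
Proof.
move=> Y0; elim: n f => [|n IHn] f dvdY; first by move=> _ [].
rewrite big_ord_recl expr0 mulr1 => sum0.
have sumE : \sum_(i < n) f (lift ord0 i) * Y ^+ lift ord0 i
  = Y * \sum_(i < n) f (lift ord0 i) * Y ^+ i.
  by rewrite mulr_sumr; apply: eq_bigr => i _; rewrite lift0 exprS mulrCA.
have f0 : f ord0 = 0.
  apply: dvdY; move/eqP: sum0; rewrite addr_eq0 => /eqP->.
  by rewrite dvdpNr sumE dvdp_mulIl.
move: sum0; rewrite f0 add0r sumE => /eqP; rewrite mulf_eq0 (negPf Y0) /= => /eqP sum0 c.
case: (unliftP ord0 c) => [j ->|->//].
by apply: (IHn (fun i => f (lift ord0 i)) _ sum0) => i; apply: dvdY.
Qed.

(** * Stepanov's auxiliary polynomial *)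

Section Stepanov.
Variables (F : finFieldType) (t : nat).

(* The monomials are chosen so that, at a point [u] where [u ^+ t] and [(u - 1) ^+ t] are known,
   every iterate of [theta] evaluates to a polynomial in [u] of degree less than [2 * d]. *)
Definition stepanov_poly d B (l : 'I_d * 'I_B * 'I_B -> F) : {poly F} :=
  \sum_i l i *: ('X^(i.1.1) * 'X^(t * i.1.2) * ('X - 1%:P) ^+ (t * i.2)).

Lemma size_stepanov_poly d B (l : 'I_d * 'I_B * 'I_B -> F) :
  (0 < d)%N -> (size (stepanov_poly l) <= d + 2 * (t * B))%N.
Proof.
move=> d_gt0; apply: leq_trans (size_sum _ _ _) _; apply/bigmax_leqP => -[[a b] c] _ /=.
apply: leq_trans (size_scale_leq _ _) _; apply: leq_trans (size_polyMleq _ _) _.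
rewrite -exprD size_polyXn size_exp_XsubC.
have : (t * b <= t * B)%N by rewrite leq_mul2l ltnW ?orbT.
have : (t * c <= t * B)%N by rewrite leq_mul2l ltnW ?orbT.
by have := ltn_ord a; lia.
Qed.

Definition shifted_pts (W : {set F * F}) : {set F} :=
  [set u | [&& u != 0, u != 1 & (u ^+ t, (u - 1) ^+ t) \in W]].

(** At a point with keys [w], the iterate of order [r] of a monomial equals [q(u)] times powers of
    [w.1] and [w.2], with [q] of size at most [2 * d] depending only on the monomial and on [r].
    Asking each coefficient in [u] to vanish costs [2 * d] equations per [w] and [r], so
    [2 * #|W| * d ^ 2] in all, against [d * B ^ 2] unknowns. *)
Lemma stepanov_system d B (W : {set F * F}) : (2 * #|W| * d < B ^ 2)%N -> (0 < d)%N ->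
  exists2 l : 'I_d * 'I_B * 'I_B -> F, (exists i, l i != 0) &
  forall u r, u \in shifted_pts W -> (r < d)%N -> root (iter r (@theta F) (stepanov_poly l)) u.
Proof.
move=> lt_WB d_gt0.
pose q (i : 'I_d * 'I_B * 'I_B) r := iter r (twist (t * i.1.2) (t * i.2)) ('X^(i.1.1) : {poly F}).
pose M (i : 'I_d * 'I_B * 'I_B) (j : {x | x \in W} * 'I_d * 'I_(2 * d)) : F :=
  (q i j.1.2)`_(j.2) * ((val j.1.1).1 ^+ i.1.2 * (val j.1.1).2 ^+ i.2).
have [|l l0 lM] := linear_system_nontrivial M.
  rewrite !card_prod !card_ord card_sig.
  by change #|[pred x in W]| with #|W|; nia.
exists l => // u r; rewrite inE => /and3P[u0 u1 uW] lt_rd.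
rewrite /stepanov_poly iter_theta_sum /root horner_sum.
have sz_q i : (size (q i r) <= 2 * d)%N.
  have szX : (size ('X^(i.1.1) : {poly F})%R <= d)%N by rewrite size_polyXn.
  have szr := size_iter_twist r (t * i.1.2) (t * i.2) szX.
  by rewrite /q; apply: leq_trans szr _; lia.
pose w : {x | x \in W} := exist _ (u ^+ t, (u - 1) ^+ t) uW.
have sum0 (j : 'I_(2 * d)) := lM (w, Ordinal lt_rd, j).
transitivity (\sum_i \sum_(j < 2 * d)
   u ^+ j * (l i * M i (w, Ordinal lt_rd, j)) == 0); last first.
  rewrite exchange_big big1 ?eqxx // => j _.
  by rewrite -mulr_sumr sum0 mulr0.
congr (_ == 0); apply: eq_bigr => i _.
rewrite iter_theta_twist -/(q i r) hornerZ !hornerM !horner_exp hornerX hornerXsubC !exprM.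
rewrite (horner_coef_wide _ (sz_q i)) !mulr_suml mulr_sumr.
by apply: eq_bigr => j _; rewrite /M /=; ring.
Qed.

Variable p : nat.
Hypothesis charFp : p \in [pchar F].

(** Expanded in powers of [(X - 1) ^ t], the digits have at most [d * B <= t] terms and size at most
    [t * B <= p], so by sparsity no nonzero digit is divisible by [(X - 1) ^ t]. Hence all digits
    would vanish, and so would [l]: the exponents [a + t * b] with [a < d <= t] are distinct. *)
Lemma stepanov_poly_neq0 d B (l : 'I_d * 'I_B * 'I_B -> F) :
  (d <= t)%N -> (d * B <= t)%N -> (t * B <= p)%N ->
  (exists i, l i != 0) -> stepanov_poly l != 0.
Proof.
move=> le_dt le_dB le_tB [[[a0 b0] c0] l0].
pose f (c : 'I_B) : {poly F} :=
  \sum_(ab : 'I_d * 'I_B) l (ab, c) *: 'X^(ab.1 + t * ab.2).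
have f_coef (a : 'I_d) (b c : 'I_B) : (f c)`_(a + t * b) = l (a, b, c).
  rewrite /f coef_sum (bigD1 (a, b)) //= coefZ coefXn eqxx mulr1 big1 ?addr0 //.
  move=> [a' b'] /= neq_ab; rewrite coefZ coefXn.
  have [eq_e|_] := (a + t * b =P a' + t * b')%N; last by rewrite mulr0.
  case/eqP: neq_ab; have lt_a := leq_trans (ltn_ord a) le_dt.
  have lt_a' := leq_trans (ltn_ord a') le_dt.
  have t_gt0 : (0 < t)%N by lia.
  have /val_inj -> : val b' = val b.
    have := congr1 (fun k => k %/ t)%N eq_e.
    by rewrite /= !(addnC _ (t * _)%N) !(mulnC t) !divnMDl // !divn_small // !addn0.
  have /val_inj -> // : val a' = val a.
  have := congr1 (fun k => k %% t)%N eq_e.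
  by rewrite /= !(addnC _ (t * _)%N) !(mulnC t) !modnMDl !modn_small.
have f_dvd c : (('X - 1%:P) ^+ t %| f c)%R -> f c = 0.
  move=> dvd_f; apply/eqP; apply: contraLR dvd_f => f_neq0.
  apply: (sparse_not_dvd charFp le_tB _ f_neq0).
    apply: leq_trans (size_sum _ _ _) _; apply/bigmax_leqP => -[a b] _ /=.
    apply: leq_trans (size_scale_leq _ _) _; rewrite size_polyXn.
    apply: (@leq_trans (t + t * b)); last by rewrite -mulnS leq_mul2l ltn_ord orbT.
    by rewrite -addSn leq_add2r (leq_trans (ltn_ord a)).
  apply: leq_trans (nterms_sum _ _) _; apply: leq_trans le_dB.
  apply: (@leq_trans (\sum_(ab : 'I_d * 'I_B) 1)); first by apply: leq_sum => ab _; apply: nterms_scaleXn.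
  by rewrite sum1_card card_prod !card_ord.
apply: contraNneq l0 => psi0; rewrite -f_coef.
suff -> : f c0 = 0 by rewrite coef0 eqxx.
apply: (adic_expansion_eq0 _ f_dvd); first by rewrite expf_neq0 // polyXsubC_eq0.
transitivity (\sum_(c < B) \sum_ab
  l (ab, c) *: ('X^(ab.1) * 'X^(t * ab.2) * ('X - 1%:P) ^+ (t * c))).
  apply: eq_bigr => c _; rewrite mulr_suml; apply: eq_bigr => ab _.
  by rewrite -scalerAl -exprD exprM.
by rewrite exchange_big pair_bigA -[RHS]psi0; apply: eq_bigr => -[[a b] c] _.
Qed.

(** Every point is a root of multiplicity [d] of a nonzero polynomial of size at most
    [d + 2 * (t * B)]. Multiplying the degree comparison by [d] gives [d ^ 2 + 2 * t * (d * B)], at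
    most [3 * t ^ 2]. *)
Theorem stepanov (W : {set F * F}) d : (0 < d)%N ->
  (8 * #|W| * d ^ 3 < t ^ 2)%N -> (t ^ 2 <= p * d)%N ->
  (#|shifted_pts W| * d ^ 2 <= 3 * t ^ 2)%N.
Proof.
move=> d_gt0 lt_W le_p.
have [W0|W_gt0] := posnP #|W|.
  suff -> : shifted_pts W = set0 by rewrite cards0.
  by apply/setP => u; rewrite !inE (cards0_eq W0) inE !andbF.
have lt_dt : (d < t)%N.
  rewrite ltnNge; apply/negP => le_td; move: lt_W; rewrite ltnNge => /negP; apply.
  by apply: (@leq_trans (d ^ 2)); [rewrite leq_exp2r | nia].
(* The largest [B] allowed by the sparsity condition [d * B <= t]. It loses at most a factor 2, so
   the hypothesis on [W] makes the system underdetermined, and [t ^ 2 <= p * d] gives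
   [t * B <= p]. *)
pose B := (t %/ d)%N.
have le_dB : (d * B <= t)%N by rewrite mulnC leq_trunc_div.
have B_gt0 : (0 < B)%N by rewrite divn_gt0 // ltnW.
have lt_tB : (t < 2 * (d * B))%N.
  by have := ltn_ceil t d_gt0; rewrite -/B; nia.
have lt_WB : (2 * #|W| * d < B ^ 2)%N by nia.
have le_tB : (t * B <= p)%N by nia.
have [l l0 l_root] := stepanov_system lt_WB d_gt0.
have psi0 := stepanov_poly_neq0 (ltnW lt_dt) le_dB le_tB l0.
have dvd_psi : (\prod_(u <- enum (shifted_pts W)) ('X - u%:P) ^+ d %| stepanov_poly l)%R.
  apply: prod_XsubC_exp_dvd; first exact: enum_uniq.
  move=> u; rewrite mem_enum => uW; apply: (iter_theta_root_dvd charFp).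
  - by nia.
  - by move: uW; rewrite inE => /and3P[].
  - by move: uW; rewrite inE => /and3P[].
  - by move=> r; apply: l_root.
have := leq_trans (dvdp_leq psi0 dvd_psi) (size_stepanov_poly l d_gt0).
have -> : size (\prod_(u <- enum (shifted_pts W)) ('X - u%:P) ^+ d) = (#|shifted_pts W| * d).+1.
  rewrite prodrXl -[LHS]prednK ?size_exp ?size_prod_XsubC -?cardE //.
  by rewrite lt0n size_poly_eq0 expf_neq0 // monic_neq0 ?monic_prod_XsubC.
nia.
Qed.

End Stepanov.

(** * Points with prescribed pairs of keys: popular pairs and moments *)

Lemma subset_of_card (T : finType) (A : {set T}) k : (k <= #|A|)%N ->
  exists2 B : {set T}, B \subset A & #|B| = k.
Proof.
move=> le_kA; exists [set x in take k (enum A)].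
  by apply/subsetP => x; rewrite inE => /mem_take; rewrite mem_enum.
rewrite cardsE; have /card_uniqP -> := take_uniq k (enum_uniq A).
by rewrite size_takel // -cardE.
Qed.

Lemma sum_geometric_decay L (X : nat -> nat) Y :
  (forall i, 2 ^ i * X i <= Y)%N -> (\sum_(i < L) X i <= 2 * Y)%N.
Proof.
elim: L X Y => [|L IHL] X Y leXY; first by rewrite big_ord0.
rewrite big_ord_recl /=.
have le0 := leXY 0%N; have := IHL (fun i => X i.+1) (Y %/ 2)%N.
have -> : (\sum_(i < L) X (bump 0 i) = \sum_(i < L) X i.+1)%N by [].
move=> /(_ _)/(leq_add le0); rewrite expn0 mul1n => H; apply: leq_trans (H _) _; last first.
  by have := leq_trunc_div Y 2; lia.
by move=> i; rewrite leq_divRL //; have := leXY i.+1; rewrite expnS; lia.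
Qed.

Section ShiftedPoints.
Variables (F : finFieldType) (t : nat).

Local Notation pts := (shifted_pts t).

Definition nshift (w : F * F) : nat := #|pts [set w]|.

Lemma card_shifted_pts W : #|pts W| = (\sum_(w in W) nshift w)%N.
Proof.
rewrite -sum1_card (partition_big (fun u => (u ^+ t, (u - 1) ^+ t)) (mem W)) /=.
  apply: eq_bigr => w wW; rewrite sum1_card; apply: eq_card => u.
  rewrite unfold_in /= !inE; case: ((u ^+ t, (u - 1) ^+ t) =P w) => [->|_].
    by rewrite wW !andbT.
  by rewrite !andbF.
by move=> u; rewrite inE => /and3P[].
Qed.

Lemma card_expr_eq_leq (c : F) : (0 < t)%N -> (#|[set x : F | x ^+ t == c]| <= t)%N.
Proof.
move=> t_gt0; rewrite cardE.
have nz : 'X^t - c%:P != 0 :> {poly F} by rewrite -size_poly_gt0 size_XnsubC.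
have := max_poly_roots nz (rs := enum [set x : F | x ^+ t == c]).
rewrite size_XnsubC // ltnS; apply; last exact: enum_uniq.
by apply/allP => x; rewrite mem_enum inE /root !hornerE subr_eq0.
Qed.

Lemma nshift_leq w : (0 < t)%N -> (nshift w <= t)%N.
Proof.
move=> t_gt0; apply: leq_trans (card_expr_eq_leq w.1 t_gt0).
apply: subset_leq_card; apply/subsetP => u; rewrite !inE => /and3P[_ _ /eqP <-].
by rewrite eqxx.
Qed.

(** Subsets of exactly [k] pairs are peeled off one by one; the extra [k] next to [#|W|] pays for
    the last, incomplete one. *)
Lemma card_shifted_pts_chunks k D Y (W : {set F * F}) : (0 < k)%N ->
  (forall W' : {set F * F}, #|W'| <= k -> #|pts W'| * D <= Y)%N ->
  (k * #|pts W| * D <= (#|W| + k) * Y)%N.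
Proof.
move=> k_gt0 leY; have [n] := ubnP #|W|; elim: n => // n IHn in W *; rewrite ltnS => le_Wn.
have [le_Wk|lt_kW] := leqP #|W| k.
  by rewrite mulnDl -mulnA; apply: leq_trans (leq_addl _ _); rewrite leq_mul2l leY ?orbT.
have [W1 sW1 cW1] := subset_of_card (ltnW lt_kW).
have cD : #|W :\: W1| = (#|W| - k)%N by rewrite cardsD (setIidPr sW1) cW1.
have -> : #|pts W| = (#|pts W1| + #|pts (W :\: W1)|)%N.
  rewrite !card_shifted_pts (big_setID W1) /= (setIidPr sW1) //.
have /IHn le2 : (#|W :\: W1| < n)%N by rewrite cD; lia.
have := leY W1; rewrite cW1 => /(_ (leqnn _)) le1.
by move: le2; rewrite cD; nia.
Qed.

Definition popular h : {set F * F} := [set w | h <= nshift w]%N.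

Variable p : nat.
Hypothesis charFp : p \in [pchar F].

Lemma stepanov_chunks (W : {set F * F}) d : (0 < d)%N -> (16 * d ^ 3 < t ^ 2)%N -> (t ^ 2 <= p * d)%N ->
  (#|pts W| * d ^ 2 <= 3 * t ^ 2 + 48 * #|W| * d ^ 3)%N.
Proof.
(* The largest number of pairs to which [stepanov] applies at this [d]; the predecessor reflects its
   strict inequality, and [16 * d ^ 3 < t ^ 2] makes [k] positive. *)
move=> d_gt0 lt_d le_p; pose k := ((t ^ 2).-1 %/ (8 * d ^ 3))%N.
have d3_gt0 : (0 < 8 * d ^ 3)%N by rewrite muln_gt0 expn_gt0 d_gt0.
have le_k : (k * (8 * d ^ 3) <= (t ^ 2).-1)%N by apply: leq_trunc_div.
have lt_k : ((t ^ 2).-1 < k.+1 * (8 * d ^ 3))%N by apply: ltn_ceil.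
have k_gt0 : (0 < k)%N by rewrite divn_gt0 //; lia.
have le_t : (t ^ 2 <= 16 * k * d ^ 3)%N by nia.
have chunk : (k * #|pts W| * d ^ 2 <= (#|W| + k) * (3 * t ^ 2))%N.
  apply: card_shifted_pts_chunks => // W' le_W'.
  by apply: (stepanov charFp) => //; nia.
have : (k * (#|pts W| * d ^ 2) <= k * (3 * t ^ 2 + 48 * #|W| * d ^ 3))%N.
  by rewrite mulnA; apply: leq_trans chunk _; nia.
by rewrite leq_pmul2l.
Qed.

(* [t <= O(p ^ (2/3))], in integers. *)
Variable c : nat.
Hypothesis t_small : (t ^ 3 <= c * p ^ 2)%N.
Hypothesis t_gt0 : (0 < t)%N.

Definition stepC := (436 + 128 ^ 2 * c ^ 3)%N.

(** When [d] is too large for [stepanov_chunks], a bound [O(#|W| * e)] with some [e <= d] is enough.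
    The largest [e] with [16 * e ^ 3 < t ^ 2] provides it, unless [t] is bounded in terms of [c]. *)
Lemma stepanov_all (W : {set F * F}) d : (0 < d)%N -> (t ^ 2 <= p * d)%N ->
  (#|pts W| * d ^ 2 <= stepC * (t ^ 2 + #|W| * d ^ 3))%N.
Proof.
have [C436 Cc] : (436 <= stepC)%N /\ (128 ^ 2 * c ^ 3 <= stepC)%N.
  by rewrite leq_addr leq_addl.
move: stepC C436 Cc => C C436 Cc d_gt0 le_p.
have [lt_d|le_d] := ltnP (16 * d ^ 3) (t ^ 2).
  by apply: leq_trans (stepanov_chunks W d_gt0 lt_d le_p) _; move: C436; clear; nia.
have [W0|W_gt0] := posnP #|W|.
  by rewrite card_shifted_pts (cards0_eq W0) big_set0.
suff [e [le_ed le_e]] : exists e, (e <= d /\ #|pts W| <= C * #|W| * e)%N.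
  apply: (@leq_trans (C * #|W| * e * d ^ 2)).
    by rewrite leq_mul2r le_e orbT.
  rewrite mulnDr; apply: leq_trans (leq_addl _ _).
  by rewrite (expnS d 2) -!mulnA !leq_mul2l leq_mul2r le_ed !orbT.
(* In the second case either [t <= 4], or [p ^ 3 < 128 * t ^ 4] and [t ^ 3 <= c * p ^ 2] together
   force [t <= 128 ^ 2 * c ^ 3]; then [nshift <= t] suffices with [e = 1]. *)
have [t_big|t_bounded] := boolP ((16 < t ^ 2) && (128 * t ^ 4 <= p ^ 3))%N; last first.
  exists 1%N; split=> //; rewrite muln1.
  apply: (@leq_trans (#|W| * t)).
    rewrite card_shifted_pts -sum_nat_const; apply: leq_sum => w _.
    exact: nshift_leq.
  rewrite mulnC leq_mul2r; apply/orP; right.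
  move: t_bounded; rewrite negb_and -leqNgt -ltnNge => /orP[le_t|lt_p]; first by nia.
  have h9 : (t ^ 9 <= c ^ 3 * p ^ 6)%N.
    have : ((t ^ 3) ^ 3 <= (c * p ^ 2) ^ 3)%N by rewrite leq_exp2r.
    by rewrite expnMn -!expnM.
  have h8 : (p ^ 6 <= 128 ^ 2 * t ^ 8)%N.
    have : ((p ^ 3) ^ 2 <= (128 * t ^ 4) ^ 2)%N by rewrite leq_exp2r // ltnW.
    by rewrite expnMn -!expnM.
  have : (t ^ 8 * t <= t ^ 8 * (128 ^ 2 * c ^ 3))%N.
    by rewrite -expnSr; apply: leq_trans h9 _; move: h8; clear; nia.
  by rewrite leq_pmul2l ?expn_gt0 ?t_gt0 // => /leq_trans; apply.
case/andP: t_big => t_big t_p.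
have ex_e : exists e, (16 * e ^ 3 < t ^ 2)%N by exists 1%N.
have ub_e e : (16 * e ^ 3 < t ^ 2)%N -> (e <= d)%N.
  move=> lt_e; rewrite leqNgt; apply/negP => lt_de.
  have : (d ^ 3 <= e ^ 3)%N by rewrite leq_exp2r // ltnW.
  by lia.
case: (ex_maxnP ex_e ub_e) => e lt_e max_e; exists e; split; first exact: ub_e.
have e_gt0 : (0 < e)%N by apply: max_e.
(* By maximality [t ^ 2 <= 16 * (e + 1) ^ 3], and [e + 1 <= 2 * e], whence [128 = 16 * 8]. Below,
   [432 = 3 * 128 + 48]. *)
have le_te : (t ^ 2 <= 128 * e ^ 3)%N.
  rewrite leqNgt; apply/negP => lt_t; have : (e.+1 <= e)%N.
    apply: max_e; apply: leq_ltn_trans lt_t.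
    have : (e.+1 ^ 3 <= (2 * e) ^ 3)%N by rewrite leq_exp2r; lia.
    by rewrite expnMn; lia.
  by rewrite ltnn.
have le_pe : (t ^ 2 <= p * e)%N.
  rewrite -(@leq_exp2r _ _ 3) // expnMn -expnM.
  apply: (@leq_trans (t ^ 4 * (128 * e ^ 3))); last by move: t_p; clear; nia.
  by rewrite -[(2 * 3)%N]/(4 + 2)%N expnD leq_mul2l le_te orbT.
have := stepanov_chunks W e_gt0 lt_e le_pe => le1.
have : (#|pts W| * e ^ 2 <= (432 * #|W| * e) * e ^ 2)%N.
  apply: leq_trans le1 _; rewrite -(mulnA _ e) -(expnS e 2).
  by move: le_te W_gt0; move: (e ^ 3)%N => e3; clear; nia.
rewrite leq_pmul2r ?expn_gt0 ?e_gt0 // => le2; apply: leq_trans le2 _.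
by rewrite leq_mul2r leq_mul2r; apply/orP; right; apply/orP; right; lia.
Qed.

Variable d0 : nat.
Hypothesis d0_gt0 : (0 < d0)%N.
Hypothesis t_d0 : (t ^ 2 <= p * d0)%N.

Definition popC := (32 * stepC ^ 3)%N.

(** Stepanov's bound at [d = h / (2 * stepC)]: the term proportional to the number of popular pairs
    is at most half of the left side and is absorbed. Then [h <= 4 * stepC * d] turns [d ^ 2] into
    [h ^ 2], which yields the constant [32 * stepC ^ 3]. *)
Lemma card_popular h : (2 * stepC * d0 <= h)%N ->
  (#|popular h| * h ^ 3 <= popC * t ^ 2)%N.
Proof.
rewrite /popC => le_h; pose d := (h %/ (2 * stepC))%N.
have C_gt0 : (0 < 2 * stepC)%N by [].
have le_d : (d0 <= d)%N by rewrite leq_divRL // mulnC.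
have le_dh : (d * (2 * stepC) <= h)%N by apply: leq_trunc_div.
have lt_hd : (h < d.+1 * (2 * stepC))%N by apply: ltn_ceil.
have d_gt0 : (0 < d)%N by apply: leq_trans le_d.
have le_p : (t ^ 2 <= p * d)%N by apply: leq_trans t_d0 _; rewrite leq_mul2l le_d orbT.
have := stepanov_all (popular h) d_gt0 le_p.
have : (#|popular h| * h <= #|pts (popular h)|)%N.
  rewrite card_shifted_pts -sum_nat_const; apply: leq_sum => w; by rewrite inE.
move: #|popular h| #|pts _| stepC C_gt0 le_dh lt_hd => w n C C_gt0 le_dh lt_hd le_n le_C.
have le1 : (w * h * d ^ 2 <= 2 * C * t ^ 2)%N.
  have : (w * h * d ^ 2 <= C * t ^ 2 + C * w * d ^ 3)%N.
    apply: leq_trans (_ : n * d ^ 2 <= _)%N; first by rewrite leq_mul2r le_n orbT.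
    by move: le_C; clear; lia.
  have : (2 * (C * w * d ^ 3) <= w * h * d ^ 2)%N.
    rewrite (expnS d 2); move: le_dh; clear => le.
    have := leq_mul (leqnn (w * d ^ 2)%N) le; lia.
  lia.
have le_h4 : (h <= 4 * C * d)%N by move: lt_hd d_gt0; clear; nia.
have le_h2 : (h ^ 2 <= 16 * C ^ 2 * d ^ 2)%N.
  have : (h ^ 2 <= (4 * C * d) ^ 2)%N by rewrite leq_exp2r.
  by rewrite !expnMn.
rewrite expnS; have := leq_mul (leqnn (w * h)%N) le_h2.
have := leq_mul (leqnn (16 * C ^ 2)%N) le1; clear; rewrite !expnS !expn0; lia.
Qed.

Definition log2S := (trunc_log 2 t).+1.

(** Dyadic decomposition of the values of [nshift], all at most [t]: [card_popular] makes each of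
    the [log2S] levels contribute [O(t ^ 2)]. *)
Lemma sum_popular_cubes h : (2 * stepC * d0 <= h)%N ->
  (\sum_(w in popular h) nshift w ^ 3 <= 8 * popC * t ^ 2 * log2S)%N.
Proof.
move=> le_h.
have cubeE w : (nshift w ^ 3 <= \sum_(i < log2S) 8 * 8 ^ i * (2 ^ i <= nshift w))%N.
  have [->|n_gt0] := posnP (nshift w); first by rewrite exp0n.
  have [lo hi] := (trunc_logP (isT : 1 < 2)%N n_gt0, trunc_log_ltn (nshift w) (isT : 1 < 2)%N).
  have lt_i : (trunc_log 2 (nshift w) < log2S)%N by rewrite ltnS leq_trunc_log // nshift_leq.
  rewrite (bigD1 (Ordinal lt_i)) //= lo muln1; apply: leq_trans (leq_addr _ _).
  have : (nshift w ^ 3 <= (2 ^ (trunc_log 2 (nshift w)).+1) ^ 3)%N by rewrite leq_exp2r // ltnW.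
  by rewrite -expnM mulnC expnM (expnS (2 ^ 3)).
apply: leq_trans (leq_sum _ _) _; first by move=> w _; apply: cubeE.
rewrite exchange_big /= mulnC -[X in (_ <= X * _)%N]card_ord -sum_nat_const.
apply: leq_sum => i _; rewrite -big_distrr /= -mulnA -mulnA leq_mul2l /=.
(* On levels below [h] the restriction to [popular h] supplies the threshold that [card_popular]
   requires. *)
have le_max : (2 * stepC * d0 <= maxn h (2 ^ i))%N by rewrite leq_max le_h.
apply: leq_trans (card_popular le_max); rewrite mulnC; apply: leq_mul.
  rewrite (eq_bigr (fun w => if 2 ^ i <= nshift w then 1 else 0)%N); last by move=> w _; case: leqP.
  rewrite -big_mkcondr sum1_card; apply/eq_leq/eq_card => w.
  by rewrite unfold_in /= !inE geq_max.
by rewrite -[8%N]/(2 ^ 3)%N -expnM mulnC expnM leq_exp2r // leq_maxr.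
Qed.

(** For squares the dyadic levels [h * 2 ^ i] decay geometrically, so the sum carries no
    logarithm. *)
Lemma sum_popular_squares h : (2 * stepC * d0 <= h)%N ->
  (h * \sum_(w in popular h) nshift w ^ 2 <= 8 * popC * t ^ 2)%N.
Proof.
move=> le_h; have h_gt0 : (0 < h)%N by apply: leq_trans le_h; rewrite muln_gt0.
have squareE w : w \in popular h ->
    (nshift w ^ 2 <= \sum_(i < log2S) (h * 2 ^ i.+1) ^ 2 * (h * 2 ^ i <= nshift w))%N.
  rewrite inE => le_hn; have m_gt0 : (0 < nshift w %/ h)%N by rewrite divn_gt0.
  have lo := trunc_logP (isT : 1 < 2)%N m_gt0.
  have hi := trunc_log_ltn (nshift w %/ h) (isT : 1 < 2)%N.
  have lt_i : (trunc_log 2 (nshift w %/ h) < log2S)%N.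
    by rewrite ltnS leq_trunc_log // (leq_trans (leq_div _ _)) // nshift_leq.
  have lo' : (h * 2 ^ trunc_log 2 (nshift w %/ h) <= nshift w)%N.
    by rewrite mulnC -leq_divRL.
  rewrite (bigD1 (Ordinal lt_i)) //= lo' muln1; apply: leq_trans (leq_addr _ _).
  by rewrite leq_exp2r // ltnW // mulnC -ltn_divLR.
apply: leq_trans (_ : h * \sum_(w in popular h) \sum_(i < log2S)
    (h * 2 ^ i.+1) ^ 2 * (h * 2 ^ i <= nshift w) <= _)%N.
  by rewrite leq_mul2l leq_sum ?orbT.
rewrite exchange_big big_distrr /=.
pose X i := (h * ((h * 2 ^ i.+1) ^ 2 * #|popular (h * 2 ^ i)|))%N.
apply: (@leq_trans (\sum_(i < log2S) X i)%N).
  apply: leq_sum => i _; rewrite -big_distrr /= !leq_mul2l; apply/orP; right.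
  apply/orP; right.
  rewrite (eq_bigr (fun w => if h * 2 ^ i <= nshift w then 1 else 0)%N); last first.
    by move=> w _; case: leqP.
  rewrite -big_mkcondr sum1_card; apply/subset_leq_card/subsetP => w.
  by rewrite unfold_in /= !inE => /andP[].
apply: leq_trans (@sum_geometric_decay _ X (4 * popC * t ^ 2)%N _) _; last first.
  by rewrite !mulnA.
move=> i; have le_hi : (2 * stepC * d0 <= h * 2 ^ i)%N.
  by apply: leq_trans le_h _; rewrite leq_pmulr // expn_gt0.
have := card_popular le_hi; move=> le_pop; rewrite /X expnS.
have := leq_mul (leqnn 4) le_pop; rewrite !mulnA; apply: leq_trans.
by rewrite (expnS 2 i); apply/eq_leq; ring.
Qed.

Lemma sum_squares_leq (P : {set F * F}) h : (2 * stepC * d0 <= h)%N ->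
  (h * \sum_(w in P) nshift w ^ 2 <= #|P| * h ^ 3 + 8 * popC * t ^ 2)%N.
Proof.
move=> le_h; apply: leq_trans (leq_add (leqnn _) (sum_popular_squares le_h)).
rewrite (expnS h 2) mulnCA -mulnDr leq_mul2l; apply/orP; right.
rewrite -sum_nat_const [X in (_ <= _ + X)%N]big_mkcond /=.
rewrite [X in (X <= _)%N]big_mkcond [X in (_ <= X + _)%N]big_mkcond -big_split /=.
apply: leq_sum => w _; rewrite inE; case: (w \in P) => //.
have [le_hn|lt_nh] := leqP h (nshift w); first exact: leq_addl.
by rewrite addn0 leq_exp2r // ltnW.
Qed.

End ShiftedPoints.

(** * Cauchy-Schwarz, counting by fibres, and cutting a sorted sequence into blocks *)

Lemma sum_sqr_leq (I : finType) (P : {set I}) (f : I -> nat) :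
  ((\sum_(i in P) f i) ^ 2 <= #|P| * \sum_(i in P) f i ^ 2)%N.
Proof.
rewrite -(leq_pmul2l (isT : 0 < 2)%N).
have -> : (2 * (\sum_(i in P) f i) ^ 2 = \sum_(i in P) \sum_(j in P) 2 * (f i * f j))%N.
  rewrite -mulnn big_distrl /= big_distrr /=; apply: eq_bigr => i _.
  by rewrite big_distrr big_distrr.
have -> : (2 * (#|P| * \sum_(i in P) f i ^ 2)
    = \sum_(i in P) \sum_(j in P) (f i ^ 2 + f j ^ 2))%N.
  under [RHS]eq_bigr do rewrite big_split /= sum_nat_const.
  by rewrite big_split /= sum_nat_const -big_distrr /= mul2n addnn.
apply: leq_sum => i _; apply: leq_sum => j _.
by rewrite (nat_Cauchy (f i) (f j)).
Qed.

Lemma card_leq_fibers (Z V : finType) (D : {set Z}) (f : Z -> V) (V0 : {set V}) (k : V -> nat) :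
  {in D, forall z, f z \in V0} ->
  {in V0, forall v, #|[set z in D | f z == v]| <= k v}%N ->
  (#|D| <= \sum_(v in V0) k v)%N.
Proof.
move=> fV0 le_k; rewrite -sum1_card (partition_big f (mem V0)) //=.
apply: leq_sum => v vV0; apply: leq_trans (le_k v vV0); rewrite sum1_card.
by apply/eq_leq/eq_card => z; rewrite unfold_in /= !inE.
Qed.

Lemma sum_leq_fibers (Z V : finType) (D : {set Z}) (f : Z -> V) (V0 : {set V})
    (g k : V -> nat) :
  {in D, forall z, f z \in V0} ->
  {in V0, forall v, #|[set z in D | f z == v]| <= k v}%N ->
  (\sum_(z in D) g (f z) <= \sum_(v in V0) k v * g v)%N.
Proof.
move=> fV0 le_k; rewrite (partition_big f (mem V0)) //=.
apply: leq_sum => v vV0; apply: leq_trans (leq_mul (le_k v vV0) (leqnn _)).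
rewrite -sum_nat_const; apply: eq_leq.
rewrite [RHS](eq_bigl (fun z => (z \in D) && (f z == v))); last by move=> z; rewrite inE.
by apply: eq_bigr => z /andP[_ /eqP->].
Qed.

Lemma card_sqr_leq_image (T U : finType) (D : {set T}) (f : T -> U) :
  (#|D| ^ 2 <= #|f @: D| * #|[set z : T * T | [&& z.1 \in D, z.2 \in D & f z.1 == f z.2]]|)%N.
Proof.
pose k u := #|[set x in D | f x == u]|.
have -> : #|D| = (\sum_(u in f @: D) k u)%N.
  rewrite -sum1_card (partition_big f (mem (f @: D))) /=; last by move=> x; exact: imset_f.
  apply: eq_bigr => u _; rewrite sum1_card.
  by apply: eq_card => z; rewrite unfold_in /= !inE.
apply: leq_trans (sum_sqr_leq _ _) _; rewrite leq_mul2l; apply/orP; right.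
rewrite -[X in (_ <= X)%N]sum1_card (partition_big (fun z => f z.1) (mem (f @: D))) /=; last first.
  by move=> z; rewrite inE => /and3P[zD _ _]; exact: imset_f.
apply: leq_sum => u _; rewrite sum1_card expnS expn1 -cardsX.
apply: subset_leq_card; apply/subsetP => -[x y] /setXP[].
rewrite !inE => /andP[xD /eqP fx] /andP[yD /eqP fy].
by rewrite unfold_in /= inE /= xD yD fx fy eqxx.
Qed.

(** Each full block dominates the next one: if [M] is the maximum of the next block, [k] times its
    sum of squares is at most [(k * M) ^ 2], and [k * M] is at most the sum over the current block.
    This shift by one block is why the first [k] entries are missing on the left. *)
Lemma sorted_blocks (T : eqType) (f : T -> nat) k (s : seq T) :
  (0 < k)%N -> sorted (fun x y => f y <= f x)%N s ->
  exists bs : seq (seq T), [/\ flatten bs = s, all (fun b => size b <= k)%N bs &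
    (k * \sum_(x <- drop k s) f x ^ 2 <= \sum_(b <- bs) (\sum_(x <- b) f x) ^ 2)%N].
Proof.
move=> k_gt0; have [n] := ubnP (size s); elim: n s => // n IHn s; rewrite ltnS => le_sn srt.
have [le_sk|lt_ks] := leqP (size s) k.
  exists [:: s]; split; rewrite /= ?cats0 ?le_sk //.
  by rewrite drop_oversize // big_nil muln0.
have [|bs [def_s sz_bs le_bs]] := IHn (drop k s) _ (drop_sorted _ srt).
  by rewrite size_drop; lia.
exists (take k s :: bs); split; first by rewrite /= def_s cat_take_drop.
  by rewrite /= size_takel ?leqnn ?sz_bs // ltnW.
rewrite big_cons -[X in (\sum_(x <- X) _)%N](cat_take_drop k (drop k s)) big_cat /= mulnDr.
apply: leq_add le_bs; set s' := drop k s; set M := (\max_(x <- s') f x)%N.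
have leM x : x \in take k s -> (M <= f x)%N.
  move=> xs; apply/bigmax_leqP_seq => y ys _.
  have tr : transitive (fun x y => f y <= f x)%N by move=> a b d ab bc; apply: leq_trans ab.
  move: srt; rewrite -(cat_take_drop k s) sorted_pairwise // pairwise_cat.
  by case/and3P => /allrelP H _ _; apply: H.
apply: (@leq_trans ((k * M) ^ 2)%N).
  rewrite expnMn (expnS k) -mulnA leq_mul2l expn1; apply/orP; right.
  apply: (@leq_trans (\sum_(x <- take k s') M ^ 2)%N).
    rewrite big_seq [X in (_ <= X)%N]big_seq; apply: leq_sum => x /mem_take xs'.
    by rewrite leq_exp2r // /M; apply: leq_bigmax_seq.
  rewrite big_const_seq count_predT iter_addn_0 mulnC leq_mul2r size_take_min.
  by rewrite geq_minl orbT.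
rewrite leq_exp2r //; apply: (@leq_trans (\sum_(x <- take k s) M)%N).
  by rewrite big_const_seq count_predT iter_addn_0 mulnC size_takel // ltnW.
by rewrite big_seq [X in (_ <= X)%N]big_seq; apply: leq_sum => x; apply: leM.
Qed.

(** * Representations [x = a - nu * b] by roots of unity *)

Section RootsOfUnitySumset.
Variables (F : finFieldType) (t : nat).
Hypothesis t_gt0 : (0 < t)%N.

Definition unity_roots : {set F} := [set x | x ^+ t == 1].
Local Notation A := unity_roots.
Hypothesis cardA : #|A| = t.

Lemma unity_rootP x : reflect (x ^+ t = 1) (x \in A).
Proof. by rewrite inE; apply: eqP. Qed.

Lemma unity_root_neq0 x : x \in A -> x != 0.
Proof.
move=> /unity_rootP xt; apply: contra_eq_neq xt => ->.
by rewrite expr0n gtn_eqF // eq_sym oner_eq0.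
Qed.

Definition nrep (nu x : F) : nat := #|[set b in A | x + nu * b \in A]|.

Lemma nrep_leq nu x : (nrep nu x <= t)%N.
Proof.
apply: (@leq_trans #|A|); last by rewrite cardA.
by apply/subset_leq_card/subsetP => b; rewrite inE => /andP[].
Qed.

(** The substitution [u = (x + nu * b) / x], for which [u - 1 = nu * b / x]: both numerators are
    known up to an element of [A], so the keys of [u] and [u - 1] depend only on [nu] and [x]. *)
Lemma nrep_nshift (nu x : F) : nu != 0 -> x != 0 ->
  (nrep nu x <= nshift t ((x ^+ t)^-1, nu ^+ t / x ^+ t))%N.
Proof.
move=> nu0 x0; rewrite /nrep /nshift.
have inj_u : injective (fun b => 1 + nu * b / x).
  by move=> b b' /addrI/(mulIf (invr_neq0 x0))/(mulfI nu0).
rewrite -(card_imset _ inj_u); apply/subset_leq_card/subsetP => _ /imsetP[b + ->].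
rewrite inE => /andP[bA xbA].
have uE : 1 + nu * b / x = (x + nu * b) / x by rewrite mulrDl divff.
have u1E : 1 + nu * b / x - 1 = nu * b / x by rewrite addrAC subrr add0r.
have [b0 xb0] := (unity_root_neq0 bA, unity_root_neq0 xbA).
rewrite inE -[_ == 1]subr_eq0 u1E uE !mulf_neq0 ?invr_neq0 //=.
rewrite !exprMn !exprVn (unity_rootP _ bA) (unity_rootP _ xbA).
by rewrite mul1r mulr1 inE.
Qed.

Lemma sum_nrep nu : (\sum_x nrep nu x = t ^ 2)%N.
Proof.
transitivity (\sum_(b in A) \sum_(x : F) ((x + nu * b)%R \in A))%N.
  rewrite exchange_big /=; apply: eq_bigr => x _.
  rewrite /nrep -sum1_card big_mkcond [RHS]big_mkcond /=.
  by apply: eq_bigr => b _; rewrite inE; case: (b \in A) => //=; case: (_ \in A).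
transitivity (\sum_(b in A) t)%N; last by rewrite sum_nat_const cardA mulnn.
apply: eq_bigr => b _; transitivity #|A| => //.
rewrite (reindex_inj (addIr (- (nu * b)))) /= -sum1_card [RHS]big_mkcond /=.
by apply: eq_bigr => x _; rewrite subrK; case: (x \in A).
Qed.

(** Discards the values below the threshold [h] from which the popularity bounds hold. *)
Definition cut (h n : nat) : nat := if (h <= n)%N then n else 0%N.

Lemma cut_mul_sqr h n m : (cut h n * m ^ 2 <= cut h n ^ 3 + cut h m ^ 3)%N.
Proof.
rewrite /cut; have [le_hn|//] := leqP h n.
have [le_mn|/ltnW le_nm] := leqP m n.
  by apply: leq_trans (leq_addr _ _); rewrite (expnS n 2) leq_mul2l leq_exp2r ?le_mn ?orbT.
rewrite (leq_trans le_hn le_nm); apply: leq_trans (leq_addl _ _).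
by rewrite (expnS m 2) leq_mul2r le_nm orbT.
Qed.

Lemma mul_sqr_leq_cut h n m : (n * m ^ 2 <= cut h n ^ 3 + cut h m ^ 3 + h ^ 2 * n)%N.
Proof.
rewrite /cut; have [le_hm|lt_mh] := leqP h m; last first.
  by apply: leq_trans (leq_addl _ _); rewrite mulnC leq_mul2r leq_exp2r // ltnW ?orbT.
have [le_mn|/ltnW le_nm] := leqP m n.
  rewrite (leq_trans le_hm le_mn) -addnA; apply: leq_trans (leq_addr _ _).
  by rewrite (expnS n 2) leq_mul2l leq_exp2r ?le_mn ?orbT.
rewrite addnAC; apply: leq_trans (leq_addl _ _).
by rewrite (expnS m 2) leq_mul2r le_nm orbT.
Qed.

Lemma sum_nrep0 : (\sum_nu nrep nu 0%R ^ 3 <= t ^ 4)%N.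
Proof.
apply: (@leq_trans (\sum_nu t ^ 2 * nrep nu 0%R)%N).
  by apply: leq_sum => nu _; rewrite (expnSr _ 2) leq_mul2r leq_exp2r ?nrep_leq ?orbT.
rewrite -big_distrr /= (expnD t 2 2) leq_mul2l; apply/orP; right.
have -> : (\sum_nu nrep nu 0%R = \sum_(b in A) \sum_(nu : F) ((nu * b)%R \in A))%N.
  rewrite exchange_big /=; apply: eq_bigr => nu _.
  rewrite /nrep -sum1_card big_mkcond [RHS]big_mkcond /=.
  by apply: eq_bigr => b _; rewrite inE add0r; case: (b \in A) => //=; case: (_ \in A).
apply: (@leq_trans (\sum_(b in A) #|A|)%N); last by rewrite sum_nat_const cardA mulnn.
apply: leq_sum => b bA.
rewrite (reindex_inj (mulIf (invr_neq0 (unity_root_neq0 bA)))) /= -sum1_card [X in (_ <= X)%N]big_mkcond /=.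
by apply: leq_sum => x _; rewrite divfK ?unity_root_neq0 //; case: (x \in A).
Qed.

(** The term [t ^ 4] is the contribution of [x = 0], where one cannot divide by [x]. For [x != 0] a
    pair of keys determines [nu ^+ t] and [x ^+ t], so it comes from at most [t ^ 2] pairs
    [(nu, x)]. *)
Lemma sum_nrep_cubes h :
  (\sum_(y : F * F | y.1 != 0%R) cut h (nrep y.1 y.2) ^ 3
   <= t ^ 4 + t ^ 2 * \sum_(w in popular F t h) nshift t w ^ 3)%N.
Proof.
rewrite (bigID (fun y => y.2 == 0)) /=; apply: leq_add.
  apply: leq_trans sum_nrep0.
  apply: (@leq_trans (\sum_(y : F * F | y.2 == 0%R) nrep y.1 0%R ^ 3)%N).
    rewrite big_mkcondr /= big_mkcond [X in (_ <= X)%N]big_mkcond /=.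
    apply: leq_sum => -[nu x] _ /=; case: ifP => // _; case: eqP => // ->.
    by rewrite leq_exp2r // /cut; case: ifP.
  rewrite -(pair_big predT (fun x : F => x == 0) (fun nu x => nrep nu 0%R ^ 3)%N) /=.
  by apply/eq_leq/eq_bigr => nu _; rewrite big_pred1_eq.
pose w (y : F * F) := ((y.2 ^+ t)^-1, y.1 ^+ t / y.2 ^+ t).
pose D := [set y : F * F | [&& y.1 != 0, y.2 != 0 & w y \in popular F t h]].
apply: (@leq_trans (\sum_(y in D) nshift t (w y) ^ 3)%N).
  rewrite big_mkcond [X in (_ <= X)%N]big_mkcond /=; apply: leq_sum => -[nu x] _ /=.
  case: ifP => // /andP[nu0 x0]; rewrite inE /= nu0 x0 inE /=.
  have le_n := nrep_nshift nu0 x0; rewrite /cut; case: (leqP h (nrep nu x)) => // le_h.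
  by rewrite (leq_trans le_h le_n) leq_exp2r.
rewrite big_distrr /=; apply: (@sum_leq_fibers _ _ _ w _ (fun v => nshift t v ^ 3)%N (fun=> t ^ 2)%N).
  by move=> y; rewrite inE => /and3P[].
move=> v _; have [y0|[y]] := set_0Vmem [set z in D | w z == v]; first by rewrite y0 cards0.
rewrite !inE => /andP[/and3P[y1 y2 _] /eqP<-].
apply: (@leq_trans #|setX [set nu : F | nu ^+ t == y.1 ^+ t] [set x : F | x ^+ t == y.2 ^+ t]|).
  apply/subset_leq_card/subsetP => -[nu x]; rewrite !inE /= /w /=.
  move=> /andP[/and3P[nu0 x0 _]] /eqP[/invr_inj xE]; rewrite xE eqxx andbT.
  by move=> /(mulIf (invr_neq0 (expf_neq0 t y2))) ->.
by rewrite cardsX expnS expn1 leq_mul // card_expr_eq_leq.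
Qed.

End RootsOfUnitySumset.

(** * Slopes, their collisions, and the energy of a block of keys *)

Section ProjectiveEnergy.
Variables (F : finFieldType) (t : nat).
Hypothesis t_gt0 : (0 < t)%N.
Local Notation A := (unity_roots F t).
Hypothesis cardA : #|A| = t.

Definition offdiag : {set F * F} := [set y | [&& y.1 \in A, y.2 \in A & y.1 != y.2]].

Definition key (y : F * F) : F := (y.1 - y.2) ^+ t.

Definition keyed (b : seq F) : {set F * F} :=
  [set y | [&& y.1 \in A, y.2 \in A & key y \in b]].

Lemma keyed_offdiag b : 0 \notin b -> keyed b \subset offdiag.
Proof.
move=> b0; apply/subsetP => y; rewrite !inE => /and3P[-> -> yb] /=.
apply: contraNneq b0 => y12.
by move: yb; rewrite /key y12 subrr expr0n gtn_eqF.
Qed.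

Definition slope (u : (F * F) * (F * F)) : F := (u.1.1 - u.1.2) / (u.2.1 - u.2.2).

(** The parameters [(nu, x)] of the affine map [z -> nu * z - x] that sends the two entries of [u.2]
    to those of [u.1]. *)
Definition slope_shift (u : (F * F) * (F * F)) : F * F :=
  (slope u, slope u * u.2.1 - u.1.1).

(* The number of [(a, a')] in [A * A] for which [(a, u.1)] and [(a', u.2)] have the same [proj]. *)
Definition nsol u : nat := nrep t (slope_shift u).1 (slope_shift u).2.

Lemma slope_neq0 u : u \in setX offdiag offdiag -> slope u != 0.
Proof.
rewrite !inE => /andP[/and3P[_ _ y12] /and3P[_ _ z12]].
by rewrite mulf_neq0 ?invr_neq0 // subr_eq0.
Qed.

(** Once [(nu, x)] is fixed, [u.2] determines [u.1], and both entries of [u.2] are elements [b] of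
    [A] with [nu * b - x] in [A]; hence the square of [nrep]. *)
Lemma sum_slope_shift_leq (D : {set (F * F) * (F * F)}) (V0 : {set F * F}) (g : F * F -> nat) :
  D \subset setX offdiag offdiag -> {in D, forall u, slope_shift u \in V0} ->
  (\sum_(u in D) g (slope_shift u) <= \sum_(v in V0) nrep t v.1 (- v.2)%R ^ 2 * g v)%N.
Proof.
move=> sD DV0; apply: sum_leq_fibers => // -[nu x] _ /=.
pose R := [set b in A | - x + nu * b \in A].
rewrite expnS expn1 -[nrep _ _ _]/#|R| -cardsX.
have inj_z : {in [set u in D | slope_shift u == (nu, x)] &, injective snd}.
  have solve u : u \in [set u in D | slope_shift u == (nu, x)] ->
      u.1 = (nu * u.2.1 - x, nu * u.2.2 - x).
    rewrite inE => /andP[/(subsetP sD) + /eqP[<- <-]].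
    rewrite !inE => /andP[_ /and3P[_ _ z12]]; case: u z12 => -[b c] [b' c'] /= z12.
    have z0 : b' - c' != 0 by rewrite subr_eq0.
    by congr (_, _); rewrite /slope /=; field.
  move=> [y z] [y' z'] /solve /= -> /solve /= -> -> //.
rewrite -(card_in_imset inj_z); apply/subset_leq_card/subsetP => _ /imsetP[u + ->].
rewrite in_set => /andP[/(subsetP sD) + /eqP[nuE xE]]; rewrite /R -nuE -xE {R nuE xE inj_z}.
case: u => -[b c] [b' c'] /setXP[].
rewrite in_set => /and3P[/= bA cA _]; rewrite in_set => /and3P[/= b'A c'A z12].
have z0 : b' - c' != 0 by rewrite subr_eq0.
rewrite in_setX.
have eq_b : - (slope (b, c, (b', c')) * b' - b) + slope (b, c, (b', c')) * b' = b by ring.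
have eq_c : - (slope (b, c, (b', c')) * b' - b) + slope (b, c, (b', c')) * c' = c.
  by rewrite /slope /=; field.
by rewrite 2!in_set /= eq_b eq_c bA cA b'A c'A.
Qed.

Definition cut_cubes h : nat := (\sum_(v : F * F | v.1 != 0%R) cut h (nrep t v.1 v.2) ^ 3)%N.

Lemma cut_cubes_opp h :
  (\sum_(v : F * F | v.1 != 0%R) cut h (nrep t v.1 (- v.2)%R) ^ 3)%N = cut_cubes h.
Proof.
rewrite /cut_cubes (reindex_inj (h := fun v : F * F => (v.1, - v.2))) /=.
  by apply: eq_bigr => v _; rewrite opprK.
by move=> [x y] [x' y'] [-> /oppr_inj ->].
Qed.

Lemma sum_cut_nsol h :
  (\sum_(u in setX offdiag offdiag) cut h (nsol u) <= 2 * cut_cubes h)%N.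
Proof.
pose V0 := [set v : F * F | v.1 != 0].
have DV0 : {in setX offdiag offdiag, forall u, slope_shift u \in V0}.
  by move=> u /slope_neq0; rewrite inE.
apply: leq_trans (sum_slope_shift_leq (fun v => cut h (nrep t v.1 v.2)) (subxx _) DV0) _.
rewrite mul2n -addnn -{2}cut_cubes_opp -big_split /=.
rewrite (eq_bigl (fun v => v.1 != 0)); last by move=> v; rewrite inE.
by apply: leq_sum => v _; rewrite mulnC cut_mul_sqr.
Qed.

(** Equal keys force the slope [nu] to lie in [A], so the values below [h] cost only [h ^ 2] times
    the sum of [nrep nu x] over [nu] in [A] and all [x], which is [t ^ 3]. *)
Lemma sum_same_key_nsol h :
  (\sum_(u in setX offdiag offdiag | key u.1 == key u.2) nsol u
   <= 2 * cut_cubes h + h ^ 2 * t ^ 3)%N.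
Proof.
pose V0 := [set v : F * F | v.1 \in A].
pose D := [set u in setX offdiag offdiag | key u.1 == key u.2].
have DV0 : {in D, forall u, slope_shift u \in V0}.
  move=> u; rewrite !inE => /andP[/andP[_ /and3P[_ _ z12]] /eqP eqk].
  by rewrite /= /slope expr_div_n -[_ ^+ t]/(key u.1) eqk divff // expf_neq0 // subr_eq0.
have sD : D \subset setX offdiag offdiag by apply/subsetP => u; rewrite inE => /andP[].
rewrite (eq_bigl (mem D)); last by move=> u; rewrite /D unfold_in /= inE.
apply: leq_trans (sum_slope_shift_leq (fun v => nrep t v.1 v.2) sD DV0) _.
apply: (@leq_trans (\sum_(v in V0) (cut h (nrep t v.1 v.2) ^ 3 +
   cut h (nrep t v.1 (- v.2)%R) ^ 3 + h ^ 2 * nrep t v.1 v.2))).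
  by apply: leq_sum => v _; rewrite mulnC mul_sqr_leq_cut.
rewrite !big_split /=; apply: leq_add; last first.
  rewrite -big_distrr /= leq_mul2l; apply/orP; right.
  rewrite (eq_bigl (fun v => (v.1 \in A) && true)); last by move=> v; rewrite inE andbT.
  rewrite -(pair_big (mem A) predT (fun nu x => nrep t nu x)) /=.
  under eq_bigr do rewrite sum_nrep //.
  by rewrite sum_nat_const cardA -expnS.
rewrite mul2n -addnn -{2}cut_cubes_opp; apply: leq_add.
  rewrite /cut_cubes big_mkcond [X in (_ <= X)%N]big_mkcond /=; apply: leq_sum => v _.
  by case: ifP => //; rewrite inE => /(unity_root_neq0 t_gt0) ->.
rewrite big_mkcond [X in (_ <= X)%N]big_mkcond /=; apply: leq_sum => v _.
by case: ifP => //; rewrite inE => /(unity_root_neq0 t_gt0) ->.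
Qed.

Definition sum_keys : {set F} := [set s ^+ t | s in sumset2 A :\ 0].

(** The possible keys of [proj z] and [proj z - 1] when both are nonzero: each is a sum of two
    elements of [A] over the same difference, whose key lies in [b]. *)
Definition block_pairs (b : seq F) : {set F * F} :=
  [set (x.1.1 / x.2, x.1.2 / x.2) | x in setX (setX sum_keys sum_keys) [set s in b]].

Lemma card_block_pairs b : (#|block_pairs b| <= #|sum_keys| ^ 2 * size b)%N.
Proof.
apply: leq_trans (leq_imset_card _ _) _; rewrite !cardsX expnS expn1 leq_mul2l.
by rewrite cardsE card_size orbT.
Qed.

Definition proj (z : F * (F * F)) : F := (z.1 + z.2.1) / (z.2.1 - z.2.2).

Lemma proj_sub1 z : z.2.1 != z.2.2 -> proj z - 1 = (z.1 + z.2.2) / (z.2.1 - z.2.2).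
Proof. by case: z => a [b c] /= bc; rewrite /proj /=; field; rewrite subr_eq0. Qed.

(** The summand 2 stands for the values 0 and 1, which [shifted_pts] excludes. *)
Lemma card_proj b : 0 \notin b ->
  (#|proj @: setX A (keyed b)| <= 2 + #|shifted_pts t (block_pairs b)|)%N.
Proof.
move=> b0; apply: (@leq_trans #|0 |: (1 |: shifted_pts t (block_pairs b))|); last first.
  rewrite (leq_trans (leq_card_setU _ _)) // cards1 -[2%N]/(1 + 1)%N -addnA leq_add2l.
  by rewrite (leq_trans (leq_card_setU _ _)) // cards1.
apply/subset_leq_card/subsetP => _ /imsetP[[a [x y]] /setXP[/= aA xyb] ->].
have := subsetP (keyed_offdiag b0) _ xyb; rewrite inE => /and3P[/= xA yA xy].
move: xyb; rewrite inE => /and3P[_ _ kb].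
rewrite !in_setU1 -[_ == 1]subr_eq0 [in X in _ || (_ || X)]inE -[_ == 1]subr_eq0 proj_sub1 //.
have [//|p0] := eqVneq (proj (a, (x, y))) 0; have [//|p1 /=] := eqVneq.
have inS s : s \in A -> a + s != 0 -> (a + s) ^+ t \in sum_keys.
  by move=> sA s0; apply: imset_f; rewrite !inE s0; apply: imset2_f.
apply/imsetP; exists ((a + x) ^+ t, (a + y) ^+ t, key (x, y)).
  rewrite !inE /= kb andbT !inS //.
    by apply: contraNneq p1 => ->; rewrite mul0r.
  by apply: contraNneq p0; rewrite /proj /= => ->; rewrite mul0r.
by rewrite /proj /key /= !expr_div_n.
Qed.

(** Cauchy-Schwarz for [proj] on [A] times the block. With the difference pairs [y] and [z] fixed, a
    collision reads [a = (nu * z.1 - y.1) + nu * a'] with [nu] the slope of [(y, z)], so [nsol]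
    counts the choices. *)
Lemma block_energy b : 0 \notin b ->
  ((t * #|keyed b|) ^ 2 <= (2 + #|shifted_pts t (block_pairs b)|) *
     \sum_(u in setX (keyed b) (keyed b)) nsol u)%N.
Proof.
move=> b0; rewrite -[X in (X * _)%N]cardA -cardsX.
apply: leq_trans (card_sqr_leq_image _ proj) _; apply: leq_mul; first exact: card_proj.
apply: (@card_leq_fibers _ _ _ (fun z => (z.1.2, z.2.2))).
  by move=> [[a y] [a' z]]; rewrite !inE /= => /and3P[/andP[_ ->] /andP[_ ->] _].
move=> [y z] /setXP[yb zb].
have := subsetP (keyed_offdiag b0) _ yb; rewrite inE => /and3P[y1A y2A y12].
have := subsetP (keyed_offdiag b0) _ zb; rewrite inE => /and3P[z1A z2A z12].
set E := [set _ in _ | _].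
have solve v : v \in E -> [/\ v.1.1 \in A, v.2.1 \in A, v.1.2 = y, v.2.2 = z &
    v.1.1 = (slope (y, z) * z.1 - y.1) + slope (y, z) * v.2.1].
  case: v => -[a y'] [a' z']; rewrite inE => /andP[+ /eqP[/= def_y def_z]].
  rewrite !inE /= => /and3P[/andP[aA _] /andP[a'A _]]; rewrite def_y def_z.
  have d0 : y.1 - y.2 != 0 by rewrite subr_eq0.
  have d0' : z.1 - z.2 != 0 by rewrite subr_eq0.
  rewrite /proj /= eqr_div // => /eqP eq_p; split=> //.
  rewrite /slope /=; apply: (addIr y.1); apply: (mulIf d0').
  by rewrite eq_p; field.
have inj_v : {in E &, injective (fun v => v.2.1)}.
  move=> [[a1 y1] [a1' z1]] [[a2 y2] [a2' z2]] /solve[/= _ _ -> -> ->] /solve[/= _ _ -> -> ->].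
  by move->.
rewrite -(card_in_imset inj_v); apply/subset_leq_card/subsetP => _ /imsetP[v /solve[v1 v2 _ _ def_v] ->].
by rewrite inE v2 /= -def_v v1.
Qed.

End ProjectiveEnergy.

(** * Additive energy expressed through the keys of differences *)

Section AdditiveEnergy.
Variables (F : finFieldType) (t : nat).
Hypothesis t_gt0 : (0 < t)%N.
Local Notation A := (unity_roots F t).
Hypothesis cardA : #|A| = t.
Local Notation keyed := (@keyed F t).
Local Notation offdiag := (offdiag F t).

(** Cauchy-Schwarz for addition on [A]; the collisions [a + b = c + d] are regrouped by the common
    difference [a - d = c - b]. *)
Lemma additive_energy_geq : (t ^ 4 <= #|sumset2 A| * \sum_(x : F) nrep t 1%R x ^ 2)%N.
Proof.
have -> : (t ^ 4 = #|setX A A| ^ 2)%N by rewrite cardsX cardA mulnn -expnM.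
apply: leq_trans (card_sqr_leq_image _ (fun z => z.1 + z.2)) _; apply: leq_mul.
  apply/subset_leq_card/subsetP => _ /imsetP[[a b] /setXP[/= aA bA] ->].
  exact: imset2_f.
rewrite (eq_bigl (mem [set: F])); last by move=> x; rewrite /= inE.
apply: (@card_leq_fibers _ _ _ (fun z => z.1.1 - z.2.2)); first by move=> z; rewrite inE.
move=> x _; rewrite expnS expn1 /nrep -cardsX.
set E := [set _ in _ | _].
have solve v : v \in E -> [/\ v.1.2 \in A, v.2.2 \in A, v.1.1 \in A, v.2.1 \in A &
    v.1.1 = x + 1 * v.2.2 /\ v.2.1 = x + 1 * v.1.2].
  case: v => -[a b] [c d]; rewrite in_set => /andP[]; rewrite in_set => /and3P[].
  move=> /setXP[/= aA bA] /setXP[/= cA dA] /eqP eq_s /eqP <-; split=> //; split; first by ring.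
  by rewrite mul1r; apply: (addIr d); rewrite -eq_s; ring.
have inj_v : {in E &, injective (fun v => (v.1.2, v.2.2))}.
  move=> [[a b] [c d]] [[a' b'] [c' d']] /solve[_ _ _ _ /= [-> ->]] /solve[_ _ _ _ /= [-> ->]].
  by case=> -> ->.
rewrite -(card_in_imset inj_v); apply/subset_leq_card/subsetP => _ /imsetP[v /solve[v1 v2 v3 v4 [e1 e2]] ->].
by apply/setXP; rewrite !in_set -?e1 -?e2; rewrite !inE in v1 v2 v3 v4; rewrite v1 v2 v3 v4.
Qed.

Lemma card_keyed_diff b x : x ^+ t \in b ->
  #|[set y in keyed b | y.1 - y.2 == x]| = nrep t 1 x.
Proof.
move=> xb; have inj_f : injective (fun c => (x + 1 * c, c)) by move=> c c' [].
rewrite /nrep -(card_imset _ inj_f); apply: eq_card => -[c d].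
rewrite in_set; apply/andP/imsetP.
  rewrite in_set => -[/and3P[/= cA dA _] /eqP def_x].
  have cE : c = x + 1 * d by rewrite -def_x; ring.
  by exists d; [rewrite in_set dA -cE | rewrite -cE].
case=> d'; rewrite in_set => /andP[d'A xdA] [-> ->].
have e : x + 1 * d' - d' = x by ring.
by rewrite in_set /= xdA d'A /key /= e xb eqxx.
Qed.

(** The ratio [y / x] lies in [A], so dilation by it carries representations of [x] to
    representations of [y]. *)
Lemma nrep_same_key (x y : F) :
  x != 0 -> x ^+ t = y ^+ t -> (nrep t 1%R x <= nrep t 1%R y)%N.
Proof.
move=> x0 eq_xy; have y0 : y != 0.
  by apply: contra_neq x0 => y0; move/eqP: eq_xy; rewrite y0 expr0n gtn_eqF // expf_eq0 t_gt0 => /eqP.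
have yx0 : y / x != 0 by rewrite mulf_neq0 ?invr_neq0.
have yxA s : s \in A -> s * (y / x) \in A.
  by rewrite !in_set => /eqP sA; rewrite exprMn expr_div_n sA -eq_xy divff ?mulr1 // expf_neq0.
rewrite /nrep -(card_imset _ (mulIf yx0)); apply/subset_leq_card/subsetP => _ /imsetP[b + ->].
rewrite !in_set => /andP[bA xbA]; have := yxA b; rewrite !in_set => -> //=.
have -> : y + 1 * (b * (y / x)) = (x + 1 * b) * (y / x) by field.
by have := yxA (x + 1 * b); rewrite !in_set; apply.
Qed.

(** On the set [Q] of elements with key [s] the function [nrep 1] has a constant value [r], so
    [#|keyed [:: s]| = #|Q| * r]. A nonempty [Q] contains a coset of [A], whence [t <= #|Q|]. *)
Lemma sum_nrep_key s : s != 0 ->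
  (t * \sum_(x : F | (x ^+ t)%R == s) nrep t 1%R x ^ 2 <= #|keyed [:: s]| ^ 2)%N.
Proof.
move=> s0; pose Q := [set x : F | x ^+ t == s].
have [Q0|[x0 x0Q]] := set_0Vmem Q.
  rewrite big1 ?muln0 // => x xs; suff : x \in Q by rewrite Q0 inE.
  by rewrite in_set.
have xs : x0 ^+ t = s by move: x0Q; rewrite in_set => /eqP.
have nz x : x ^+ t = s -> x != 0.
  by move=> xts; apply: contra_neq s0 => x00; rewrite -xts x00 expr0n gtn_eqF.
have nrepE x : x ^+ t == s -> nrep t 1 x = nrep t 1 x0.
  by move=> /eqP xts; apply/eqP; rewrite eqn_leq !nrep_same_key ?nz ?xts.
rewrite (eq_bigr (fun=> nrep t 1%R x0 ^ 2)%N); last by move=> x /nrepE ->.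
have -> : #|keyed [:: s]| = (#|Q| * nrep t 1%R x0)%N.
  rewrite -sum1_card (partition_big (fun y => y.1 - y.2) (mem Q)) /=; last first.
    by move=> y; rewrite in_set => /and3P[_ _]; rewrite !in_set inE.
  rewrite -sum_nat_const; apply: eq_bigr => x; rewrite in_set => xts.
  rewrite sum1_card -(nrepE x) // -(@card_keyed_diff [:: s] x) ?inE //.
  by apply: eq_card => y; rewrite unfold_in /= [RHS]in_set.
have -> : (\sum_(x : F | (x ^+ t)%R == s) nrep t 1%R x0 ^ 2 = #|Q| * nrep t 1%R x0 ^ 2)%N.
  by rewrite -sum_nat_const; apply: eq_bigl => x; rewrite in_set.
have le_tQ : (t <= #|Q|)%N.
  rewrite -[X in (X <= _)%N]cardA -(card_imset _ (mulIf (nz _ xs))).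
  apply/subset_leq_card/subsetP => _ /imsetP[a + ->].
  by rewrite !in_set exprMn => /eqP->; rewrite mul1r xs.
by rewrite expnMn mulnA leq_mul2r (expnS #|Q|) expn1 leq_mul2r le_tQ !orbT.
Qed.

Lemma energy_keyed :
  (t * \sum_(x : F) nrep t 1%R x ^ 2 <= t ^ 3 + \sum_(s : F | s != 0%R) #|keyed [:: s]| ^ 2)%N.
Proof.
rewrite (bigD1 0) //= mulnDr; apply: leq_add.
  by rewrite (expnS t 2) leq_mul2l leq_exp2r // nrep_leq ?orbT.
rewrite (partition_big (fun x => x ^+ t) (fun s => s != 0)) /=; last first.
  by move=> x x0; rewrite expf_neq0.
rewrite big_distrr /=; apply: leq_sum => s s0; apply: leq_trans (sum_nrep_key s0).
rewrite leq_mul2l big_mkcond [X in (_ <= X)%N]big_mkcond /=; apply/orP; right.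
by apply: leq_sum => x _; case: (_ == s); rewrite ?andbF ?andbT //; case: ifP.
Qed.

Lemma card_keyed1_leq s : s != 0 -> (#|keyed [:: s]| <= t * nshift t (s^-1, s^-1))%N.
Proof.
move=> s0; apply: (@leq_trans (\sum_(x in [set x : F | x ^+ t == s]) nshift t (s^-1, s^-1))%N).
  apply: (@card_leq_fibers _ _ _ (fun y => y.1 - y.2)).
    by move=> y; rewrite in_set => /and3P[_ _]; rewrite !in_set inE.
  move=> x; rewrite in_set => /eqP xs; rewrite card_keyed_diff ?xs ?inE //.
  have x0 : x != 0 by apply: contra_neq s0 => x0; rewrite -xs x0 expr0n gtn_eqF.
  by have := nrep_nshift t_gt0 (oner_neq0 F) x0; rewrite expr1n xs mul1r.
by rewrite sum_nat_const leq_mul2r card_expr_eq_leq ?orbT.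
Qed.

Lemma card_keyed_cons s b : s \notin b ->
  #|keyed (s :: b)| = (#|keyed [:: s]| + #|keyed b|)%N.
Proof.
move=> sb; rewrite -cardsUI (_ : _ :&: _ = set0) ?cards0 ?addn0.
  by apply: eq_card => y; rewrite !in_set !inE -!andb_orr.
apply/setP => y; rewrite !in_set !inE; case: (key t y =P s) => [->|_]; rewrite ?andbF //.
by rewrite (negPf sb) !andbF.
Qed.

Lemma sum_card_keyed b : uniq b -> (\sum_(s <- b) #|keyed [:: s]|)%N = #|keyed b|.
Proof.
elim: b => [|s b IHb] /=.
  by rewrite big_nil => _; apply/esym/eqP; rewrite cards_eq0; apply/eqP/setP => y; rewrite !in_set in_nil !andbF.
by move=> /andP[sb /IHb eq_b]; rewrite big_cons eq_b (card_keyed_cons sb).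
Qed.

Lemma sum_blocks_leq (bs : seq (seq F)) (f : (F * F) * (F * F) -> nat) :
  uniq (flatten bs) -> 0 \notin flatten bs ->
  (\sum_(b <- bs) \sum_(u in setX (keyed b) (keyed b)) f u
    <= \sum_(u in setX offdiag offdiag) f u)%N.
Proof.
move=> uq nz; apply: (@leq_trans (\sum_(u in setX (keyed (flatten bs)) (keyed (flatten bs))) f u)%N); last first.
  rewrite big_mkcond [X in (_ <= X)%N]big_mkcond /=; apply: leq_sum => -[y z] _.
  case: ifP => // /setXP[yb zb].
  by rewrite (_ : (y, z) \in _ = true) //; apply/setXP; split; apply: (subsetP (keyed_offdiag t_gt0 nz)).
elim: bs uq {nz} => [|b bs IHbs] /=; first by rewrite big_nil.
rewrite cat_uniq => /and3P[_ /hasPn disj uq]; rewrite big_cons.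
apply: leq_trans (leq_add (leqnn _) (IHbs uq)) _.
rewrite big_mkcond [X in (_ + X <= _)%N]big_mkcond [X in (_ <= X)%N]big_mkcond -big_split /=.
have sub_cat b' : {subset b' <= b ++ flatten bs} -> keyed b' \subset keyed (b ++ flatten bs).
  by move=> sb'; apply/subsetP => y; rewrite !in_set => /and3P[-> -> /sb' ->].
have sub1 := sub_cat b (mem_subseq (prefix_subseq _ _)).
have sub2 := sub_cat (flatten bs) (mem_subseq (suffix_subseq _ _)).
apply: leq_sum => -[y z] _; case: (boolP ((y, z) \in setX (keyed b) _)) => [yz1|_].
  have [y1 z1] := setXP yz1.
  rewrite (_ : (y, z) \in setX (keyed (flatten bs)) _ = false); last first.
    apply/negbTE/negP => /setXP[+ _]; move: y1; rewrite !in_set => /and3P[_ _ yb] /and3P[_ _ /disj].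
    by rewrite yb.
  rewrite addn0 (_ : (y, z) \in _ = true) //; apply/setXP; split; exact: (subsetP sub1).
rewrite add0n; case: ifP => // /setXP[y2 z2].
rewrite (_ : (y, z) \in _ = true) //; apply/setXP; split; exact: (subsetP sub2).
Qed.

Lemma card_sumset_leq : (#|sumset2 A| <= #|sum_keys F t| * t + 1)%N.
Proof.
rewrite (cardsD1 0) addnC; apply: leq_add; last by case: (_ \in _).
rewrite -sum_nat_const; apply: (@card_leq_fibers _ _ _ (fun s => s ^+ t)).
  by move=> s sS; apply: imset_f.
move=> k _; apply: leq_trans (card_expr_eq_leq k t_gt0).
by apply/subset_leq_card/subsetP => s; rewrite !in_set => /andP[].
Qed.

(** The sumset is stable under multiplication by [A], so each key is attained on a full coset. *)
Lemma card_sumset_geq : (#|sum_keys F t| * t <= #|sumset2 A|)%N.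
Proof.
rewrite -sum_nat_const; apply: (@leq_trans #|sumset2 A :\ 0|); last by rewrite subset_leq_card // subsetDl.
rewrite -[X in (_ <= X)%N]sum1_card.
rewrite [X in (_ <= X)%N](partition_big (fun s => s ^+ t) (mem (sum_keys F t))) /=; last by move=> s sS; apply/imsetP; exists s.
apply: leq_sum => _ /imsetP[s + ->]; rewrite in_setD1 => /andP[s0 /imset2P[x y xA yA def_s]].
rewrite sum1_card -[X in (X <= _)%N]cardA -(card_imset _ (mulIf s0)).
apply/subset_leq_card/subsetP => _ /imsetP[a aA ->].
have a0 := unity_root_neq0 t_gt0 aA.
rewrite unfold_in /= in_setD1 mulf_neq0 //= exprMn (unity_rootP _ _ aA) mul1r eqxx andbT.
by rewrite def_s mulrDr; apply: imset2_f; rewrite in_set exprMn !(unity_rootP _ _ _) ?mulr1.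
Qed.

Lemma card_sum_keys_gt0 : (1 < t)%N -> (0 < #|sum_keys F t|)%N.
Proof.
move=> t_gt1; have A1 : 1 \in A by rewrite in_set expr1n.
have [a aA a1] : exists2 a, a \in A & a != -1.
  apply/exists_inP; apply: contraTT t_gt1 => /exists_inPn all1; rewrite -leqNgt -cardA.
  rewrite -(cards1 (-1 : F)); apply/subset_leq_card/subsetP => a /all1.
  by rewrite negbK in_set1.
rewrite card_gt0; apply/set0Pn; exists ((a + 1) ^+ t); apply: imset_f.
by rewrite in_setD1 addr_eq0 a1 imset2_f.
Qed.

End AdditiveEnergy.

(** * The inequality for the number [m] of keys of the sumset *)

Lemma uniq_flatten_mem (T : eqType) (bs : seq (seq T)) b :
  uniq (flatten bs) -> b \in bs -> uniq b.
Proof.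
elim: bs => //= b' bs IHbs; rewrite cat_uniq inE => /and3P[uq _ /IHbs{}IHbs].
by case/predU1P => [->|/IHbs].
Qed.

Section SumsetKeys.
Variables (F : finFieldType) (p t c c' d0 : nat).
Hypothesis charFp : p \in [pchar F].
Hypothesis t_gt1 : (1 < t)%N.
Hypothesis t_small : (t ^ 3 <= c * p ^ 2)%N.
Hypothesis d0_gt0 : (0 < d0)%N.
Hypothesis t_d0 : (t ^ 2 <= p * d0)%N.
Hypothesis d0_small : (d0 ^ 2 <= c' * t)%N.
Local Notation A := (unity_roots F t).
Hypothesis cardA : #|A| = t.

Let t_gt0 : (0 < t)%N := ltnW t_gt1.
Local Notation keyed := (@keyed F t).
Local Notation offdiag := (offdiag F t).
Local Notation nsol := (@nsol F t).
Local Notation L := (log2S t).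
Local Notation m := #|sum_keys F t|.
Local Notation h0 := (2 * stepC c * d0)%N.
Local Notation sumX := (\sum_(s : F | s != 0%R) #|keyed [:: s]| ^ 2)%N.

Definition cubeC := (1 + 8 * popC c)%N.
Definition imageC := (2 + 2 * stepC c)%N.
Definition headC := (64 + 8 * popC c)%N.
Definition flatC := (2 * cubeC + 4 * stepC c ^ 2 * c')%N.

Lemma cut_cubes_leq : (cut_cubes F t h0 <= cubeC * t ^ 4 * L)%N.
Proof.
apply: leq_trans (sum_nrep_cubes t_gt0 cardA h0) _.
have le_pop := sum_popular_cubes charFp t_small t_gt0 d0_gt0 t_d0 (leqnn h0).
apply: leq_trans (leq_add (leqnn _) (leq_mul (leqnn (t ^ 2)) le_pop)) _.
rewrite /cubeC (expnD t 2 2); have : (0 < L)%N by [].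
move: (popC c) (t ^ 2)%N L => P T l; clear; nia.
Qed.

Lemma image_leq (b : seq F) d : (0 < d)%N -> (t ^ 2 <= p * d)%N ->
  ((2 + #|shifted_pts t (block_pairs t b)|) * d ^ 2
    <= 2 * d ^ 2 + stepC c * (t ^ 2 + m ^ 2 * size b * d ^ 3))%N.
Proof.
move=> d_gt0 le_d; rewrite mulnDl leq_add2l.
apply: leq_trans (stepanov_all charFp t_small t_gt0 _ d_gt0 le_d) _.
by rewrite leq_mul2l leq_add2l leq_mul2r card_block_pairs !orbT.
Qed.

(* Blocks reduced to one key: then [nu] lies in [A] and no absorption is needed. *)
Lemma sum_keyed_single d : (d0 <= d)%N -> (t ^ 2 <= m ^ 2 * d ^ 3)%N ->
  (sumX <= imageC * flatC * m ^ 2 * d * t ^ 2 * L)%N.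
Proof.
move=> le_d le_t; have d_gt0 := leq_trans d0_gt0 le_d.
have le_pd : (t ^ 2 <= p * d)%N by apply: leq_trans t_d0 _; rewrite leq_mul2l le_d orbT.
have m_gt0 : (0 < m)%N by apply: card_sum_keys_gt0.
pose En s := (\sum_(u in setX (keyed [:: s]) (keyed [:: s])) nsol u)%N.
have leX s : s != 0 -> (t ^ 2 * #|keyed [:: s]| ^ 2 <= imageC * m ^ 2 * d * En s)%N.
  move=> s0; rewrite -expnMn; apply: leq_trans (block_energy t_gt0 cardA _) _.
    by rewrite inE eq_sym.
  rewrite leq_mul2r; apply/orP; right.
  have := image_leq [:: s] d_gt0 le_pd; rewrite muln1 => leV.
  have d2_gt0 : (0 < d ^ 2)%N by rewrite expn_gt0 d_gt0.
  rewrite -(leq_pmul2r d2_gt0); apply: leq_trans leV _.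
  rewrite -(mulnA _ d) -(expnS d 2) -(mulnA imageC) /imageC.
  have : (d ^ 2 <= m ^ 2 * d ^ 3)%N.
    rewrite (expnS d 2) mulnA; apply: leq_pmull; by rewrite muln_gt0 expn_gt0 m_gt0 d_gt0.
  move: (stepC c) (d ^ 2)%N (m ^ 2 * d ^ 3)%N le_t => S D M; clear; nia.
(* Two pairs in the same one-key block have equal keys, so all these energies fit disjointly into
   the sum over pairs with the same key. *)
have sumE : (\sum_(s : F | s != 0%R) En s <= 2 * cut_cubes F t h0 + h0 ^ 2 * t ^ 3)%N.
  apply: leq_trans (sum_same_key_nsol t_gt0 cardA h0).
  rewrite big_mkcondr /=; pose ks := enum [set s : F | s != 0].
  have eq_ks : flatten [seq [:: s] | s <- ks] = ks.
    by rewrite (flatten_map1 id) map_id.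
  have := @sum_blocks_leq F t t_gt0 [seq [:: s] | s <- ks]
    (fun u => if key t u.1 == key t u.2 then nsol u else 0%N).
  rewrite eq_ks enum_uniq mem_enum in_set eqxx big_map big_enum /= => /(_ isT isT).
  apply: leq_trans; apply: eq_leq; rewrite [RHS](eq_bigl (fun s => s != 0)); last by move=> s; rewrite in_set.
  apply: eq_bigr => s _; apply: eq_bigr => -[y z] /setXP[].
  rewrite !in_set !inE => /and3P[_ _ /eqP ky] /and3P[_ _ /eqP kz] /=.
  by rewrite ky kz eqxx.
have t2_gt0 : (0 < t ^ 2)%N by rewrite expn_gt0 t_gt0.
rewrite -(leq_pmul2l t2_gt0) big_distrr /=.
apply: leq_trans (leq_sum _ _) _; first by move=> s s0; apply: leX.
rewrite -big_distrr /=; apply: leq_trans (leq_mul (leqnn _) sumE) _.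
(* The hypothesis [d0 ^ 2 <= c' * t] enters here: it makes [h0 ^ 2 * t ^ 3] of order [t ^ 4]. *)
have le_flat : (2 * cut_cubes F t h0 + h0 ^ 2 * t ^ 3 <= flatC * t ^ 4 * L)%N.
  have := cut_cubes_leq; rewrite /flatC; have : (0 < L)%N by [].
  have : (h0 ^ 2 <= 4 * stepC c ^ 2 * c' * t)%N.
    by rewrite !expnMn -(mulnA _ c' t) leq_mul2l d0_small orbT.
  rewrite (expnS t 3); move: (h0 ^ 2)%N (t ^ 3)%N (cut_cubes _ _ _) cubeC (stepC c ^ 2)%N L => H T Q C S l.
  move=> leH l_gt0 leQ; rewrite (mulnDl (2 * C)%N) (mulnDl _ _ l); apply: leq_add.
    by have := leq_mul (leqnn 2) leQ; rewrite !mulnA.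
  apply: (@leq_trans (H * T * l)); first exact: leq_pmulr.
  by rewrite leq_mul2r (mulnA _ t T) leq_mul2r leH !orbT.
apply: leq_trans (leq_mul (leqnn _) le_flat) _; apply: eq_leq.
by move: imageC flatC m L => I K n l; ring.
Qed.

(* [g] stands for [m ^ (1/3)]; the blocks have size [t ^ 2 / (m ^ 2 * d ^ 3)], which makes the two
   terms of the image bound comparable. *)
Lemma sum_keyed_blocks d g : (0 < g)%N -> (g ^ 3 <= 8 * m)%N -> (m <= g ^ 3)%N ->
  (h0 <= d)%N -> (2 * imageC * h0 <= d)%N -> (4 * headC * g <= d)%N ->
  (m ^ 2 * d ^ 3 < t ^ 2)%N ->
  (4 * m * sumX <= t ^ 4 + 32 * imageC * cubeC * m ^ 3 * d * t ^ 2 * L)%N.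
Proof.
move=> g_gt0 le_g3 le_mg le_h0 le_ih le_hg lt_t.
have d_gt0 : (0 < d)%N by apply: leq_trans le_h0; rewrite muln_gt0 d0_gt0.
have m_gt0 : (0 < m)%N by apply: card_sum_keys_gt0.
have le_pd : (t ^ 2 <= p * d)%N.
  apply: leq_trans t_d0 _; rewrite leq_mul2l; apply/orP; right.
  by apply: leq_trans le_h0; apply: leq_pmull.
have D_gt0 : (0 < m ^ 2 * d ^ 3)%N by rewrite muln_gt0 !expn_gt0 m_gt0 d_gt0.
pose k := (t ^ 2 %/ (m ^ 2 * d ^ 3))%N.
have k_gt0 : (0 < k)%N by rewrite divn_gt0 // ltnW.
have le_kt : (k * (m ^ 2 * d ^ 3) <= t ^ 2)%N by apply: leq_trunc_div.
have lt_tk : (t ^ 2 <= 2 * k * (m ^ 2 * d ^ 3))%N.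
  have := ltn_ceil (t ^ 2) D_gt0; rewrite -/k; move: k_gt0 (m ^ 2 * d ^ 3)%N (t ^ 2)%N.
  by clear; nia.
pose X s := #|keyed [:: s]|.
pose ge x y := (X y <= X x)%N.
pose ks := sort ge (enum [set s : F | s != 0]).
have ks_uniq : uniq ks by rewrite sort_uniq enum_uniq.
have ks0 : 0 \notin ks by rewrite mem_sort mem_enum in_set eqxx.
have sumXE : sumX = (\sum_(s <- ks) X s ^ 2)%N.
  rewrite (perm_big _ (permEl (perm_sort _ _))) big_enum /=.
  by apply: eq_bigl => s; rewrite in_set.
have ks_sorted : sorted ge ks by apply: sort_sorted => x y; apply: leq_total.
have [bs [def_ks sz_bs le_bs]] := sorted_blocks k_gt0 ks_sorted.
have d2_gt0 : (0 < d ^ 2)%N by rewrite expn_gt0 d_gt0.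
have le_d2 : (d ^ 2 <= t ^ 2)%N.
  apply: leq_trans (ltnW lt_t); rewrite (expnS d 2) mulnA.
  by apply: leq_pmull; rewrite muln_gt0 expn_gt0 m_gt0 d_gt0.
pose Ec b := (\sum_(u in setX (keyed b) (keyed b)) cut h0 (nsol u))%N.
have leXb b : b \in bs -> (d ^ 2 * (\sum_(s <- b) X s) ^ 2 <= 2 * imageC * Ec b)%N.
  move=> b_bs; have sub_b : {subset b <= ks}.
    by move=> s sb; rewrite -def_ks; apply/flattenP; exists b.
  have b_uniq : uniq b by apply: (@uniq_flatten_mem _ bs); rewrite ?def_ks.
  have b0 : 0 \notin b by apply: contra ks0; apply: sub_b.
  rewrite sum_card_keyed //; set Xb := #|keyed b|.
  have le_E : (\sum_(u in setX (keyed b) (keyed b)) nsol u <= h0 * Xb ^ 2 + Ec b)%N.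
    rewrite mulnC (expnS Xb 1) expn1 -cardsX -sum_nat_const -big_split /=.
    apply: leq_sum => u _; rewrite /cut; case: (leqP h0 (nsol u)) => [_|/ltnW le_u].
      exact: leq_addl.
    by rewrite addn0.
  have leV := image_leq b d_gt0 le_pd.
  have leV' : ((2 + #|shifted_pts t (block_pairs t b)|) * d ^ 2 <= imageC * t ^ 2)%N.
    apply: leq_trans leV _; rewrite /imageC.
    have : (m ^ 2 * size b * d ^ 3 <= t ^ 2)%N.
      apply: leq_trans le_kt; rewrite mulnAC mulnC leq_mul2r.
      by rewrite (allP sz_bs _ b_bs) orbT.
    by move: (stepC c) (m ^ 2 * size b * d ^ 3)%N le_d2; clear; nia.
  have t2_gt0 : (0 < t ^ 2)%N by rewrite expn_gt0 t_gt0.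
  have le1 : (d ^ 2 * Xb ^ 2 <= imageC * (h0 * Xb ^ 2 + Ec b))%N.
    rewrite -(leq_pmul2l t2_gt0).
    have le2 := leq_trans (block_energy t_gt0 cardA b0) (leq_mul (leqnn _) le_E).
    have := leq_mul (leqnn (d ^ 2)%N) le2; rewrite expnMn -/Xb => le3.
    rewrite mulnCA; apply: leq_trans le3 _; rewrite mulnA (mulnC (d ^ 2)%N).
    by apply: leq_trans (leq_mul leV' (leqnn _)) _; rewrite (mulnC imageC) -mulnA.
  (* The term [imageC * h0 * Xb ^ 2] is absorbed. *)
  have : (2 * imageC * h0 * Xb ^ 2 <= d ^ 2 * Xb ^ 2)%N.
    rewrite leq_mul2r; apply/orP; right; apply: leq_trans le_ih _.
    by rewrite (expnS d 1) expn1 leq_pmulr.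
  by move: le1; rewrite mulnDr -!mulnA; move: imageC (Ec b) (Xb ^ 2)%N => I E Y; clear; lia.
(* [leXb] is summed over the disjoint blocks and divided by [k * d ^ 2]; the lower bound [lt_tk] for
   [k] converts this into the factor [m ^ 2 * d]. *)
have le_tail : (\sum_(s <- drop k ks) X s ^ 2 <= 8 * imageC * cubeC * m ^ 2 * d * t ^ 2 * L)%N.
  have sumEc : (\sum_(b <- bs) Ec b <= 2 * (cubeC * t ^ 4 * L))%N.
    apply: leq_trans (sum_blocks_leq t_gt0 _ _ _) _; rewrite ?def_ks //.
    by apply: leq_trans (sum_cut_nsol F t h0) _; rewrite leq_mul2l cut_cubes_leq orbT.
  have : (d ^ 2 * (k * \sum_(s <- drop k ks) X s ^ 2) <= 4 * imageC * (cubeC * t ^ 4 * L))%N.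
    apply: leq_trans (leq_mul (leqnn _) le_bs) _; rewrite big_distrr /=.
    apply: (@leq_trans (\sum_(b <- bs) 2 * imageC * Ec b)%N).
      by rewrite big_seq [X in (_ <= X)%N]big_seq; apply: leq_sum => b; apply: leXb.
    rewrite -big_distrr /=; apply: leq_trans (leq_mul (leqnn _) sumEc) _.
    by apply: eq_leq; move: imageC cubeC L => I K l; ring.
  move=> le1; have kd_gt0 : (0 < k * d ^ 2)%N by rewrite muln_gt0 k_gt0.
  rewrite -(leq_pmul2l kd_gt0) -mulnA mulnCA; apply: leq_trans le1 _.
  have le2 := leq_mul (leqnn (4 * imageC * (cubeC * t ^ 2 * L))%N) lt_tk.
  apply: (@leq_trans (4 * imageC * (cubeC * t ^ 2 * L) * t ^ 2)).
    by apply: eq_leq; move: imageC cubeC L => I K l; ring.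
  apply: leq_trans le2 _; apply: eq_leq; move: imageC cubeC m L (k) => I K n l j; ring.
have le_head : (4 * m * \sum_(s <- take k ks) X s ^ 2 <= t ^ 4)%N.
  pose P := [set (s^-1, s^-1) | s in [set s in take k ks]].
  have cardP : (#|P| <= k)%N.
    rewrite (leq_trans (leq_imset_card _ _)) // cardsE (leq_trans (card_size _)) //.
    by rewrite size_take_min geq_minl.
  have le_X : (\sum_(s <- take k ks) X s ^ 2 <= t ^ 2 * \sum_(w in P) nshift t w ^ 2)%N.
    rewrite big_imset /=; last by move=> x y _ _ [/invr_inj].
    rewrite [in X in (_ <= _ * X)%N](eq_bigl (mem (take k ks))); last by move=> s; rewrite in_set.
    rewrite -big_uniq ?take_uniq //= big_distrr /=.
    rewrite big_seq [X in (_ <= X)%N]big_seq; apply: leq_sum => s s_ks.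
    rewrite -expnMn leq_exp2r // card_keyed1_leq //.
    by apply: contraNneq ks0 => <-; apply: mem_take s_ks.
  (* As [g ^ 3] is comparable to [m], [h ^ 3] is comparable to [m ^ 2 * d ^ 3], which balances the
     two terms of [sum_squares_leq] for a set of [k] pairs. Moreover [d >= 4 * headC * g] gives
     [h >= 4 * headC * m]. *)
  pose h := (g ^ 2 * d)%N.
  have h_gt0 : (0 < h)%N by rewrite muln_gt0 expn_gt0 g_gt0 d_gt0.
  have le_h : (h0 <= h)%N by apply: leq_trans le_h0 _; rewrite leq_pmull // expn_gt0 g_gt0.
  have le_sq := sum_squares_leq charFp t_small t_gt0 d0_gt0 t_d0 P le_h.
  have le_h3 : (#|P| * h ^ 3 <= 64 * t ^ 2)%N.
    apply: (@leq_trans (64 * (k * (m ^ 2 * d ^ 3)))); last by rewrite leq_mul2l le_kt orbT.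
    have : (h ^ 3 <= 64 * (m ^ 2 * d ^ 3))%N.
      rewrite /h expnMn -expnM (expnM g 3 2) mulnA leq_mul2r; apply/orP; right.
      by rewrite -[64%N]/(8 ^ 2)%N -expnMn leq_exp2r.
    by move=> /(leq_mul cardP) le3; apply: leq_trans le3 _; rewrite mulnCA.
  have le_sum : (h * \sum_(w in P) nshift t w ^ 2 <= headC * t ^ 2)%N.
    by apply: leq_trans le_sq _; rewrite /headC mulnDl leq_add2r.
  have le_m : (4 * headC * m <= h)%N.
    apply: leq_trans (_ : g ^ 2 * (4 * headC * g) <= _)%N.
      rewrite mulnCA -(expnSr g 2); by rewrite leq_mul2l le_mg orbT.
    by rewrite leq_mul2l le_hg orbT.
  have : (4 * m * \sum_(w in P) nshift t w ^ 2 <= t ^ 2)%N.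
    rewrite -(leq_pmul2l h_gt0) mulnCA; apply: leq_trans (leq_mul (leqnn _) le_sum) _.
    apply: (@leq_trans (4 * headC * m * t ^ 2)); last by rewrite leq_mul2r le_m orbT.
    by apply: eq_leq; move: headC m => H n; ring.
  move=> le_fin; apply: leq_trans (leq_mul (leqnn _) le_X) _.
  by rewrite mulnCA (expnD t 2 2) leq_mul2l le_fin orbT.
rewrite sumXE -(cat_take_drop k ks) big_cat /= mulnDr; apply: leq_add le_head _.
by apply: leq_trans (leq_mul (leqnn _) le_tail) _; apply: eq_leq; move: imageC cubeC m L => I K n l; ring.
Qed.

Definition keysC := (4 + (2 * imageC * flatC + 32 * imageC * cubeC) *
  (2 * stepC c * (1 + 2 * imageC) + 4 * headC))%N.

(** With [d] above every required lower bound, blocks longer than one key make sense only if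
    [m ^ 2 * d ^ 3 < t ^ 2]; otherwise single keys are used. In the block case the energy inequality
    contains [2 * m * sumX], whose head is at most [t ^ 4 / 2] and moves to the left side. *)
Lemma sum_keys_bound g : (0 < g)%N -> (g ^ 3 <= 8 * m)%N -> (m <= g ^ 3)%N ->
  (t ^ 2 <= keysC * (m * t + L * m ^ 3 * (g + d0)))%N.
Proof.
move=> g_gt0 le_g3 le_mg; have m_gt0 : (0 < m)%N by apply: card_sum_keys_gt0.
pose d := (h0 + 2 * imageC * h0 + 4 * headC * g)%N.
have le_h0 : (h0 <= d)%N := leq_trans (leq_addr _ _) (leq_addr _ _).
have le_ih : (2 * imageC * h0 <= d)%N := leq_trans (leq_addl _ _) (leq_addr _ _).
have le_hg : (4 * headC * g <= d)%N := leq_addl _ _.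
have le_d0 : (d0 <= d)%N by apply: leq_trans le_h0; apply: leq_pmull.
have t2_gt0 : (0 < t ^ 2)%N by rewrite expn_gt0 t_gt0.
have energy : (t ^ 4 <= 2 * m * t ^ 3 + 2 * m * sumX)%N.
  rewrite -(leq_pmul2l t_gt0).
  have le1 := leq_mul (leqnn t) (additive_energy_geq cardA).
  apply: leq_trans le1 _; rewrite mulnCA.
  apply: leq_trans (leq_mul (card_sumset_leq F t_gt0) (energy_keyed t_gt0 cardA)) _.
  apply: (@leq_trans (2 * m * t * (t ^ 3 + sumX))).
    rewrite leq_mul2r; apply/orP; right.
    by move: (muln_gt0 m t) t_gt0 m_gt0; case: (m * t)%N (mulnA 2 m t) => [|n] <-; lia.
  by apply: eq_leq; move: m sumX => n X; ring.
pose K := (2 * imageC * flatC + 32 * imageC * cubeC)%N.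
have core : (t ^ 2 <= 4 * m * t + K * (m ^ 3 * d * L))%N.
  rewrite -(leq_pmul2l t2_gt0); have [le_t|lt_t] := leqP (t ^ 2) (m ^ 2 * d ^ 3).
    have := leq_mul (leqnn (2 * m)%N) (sum_keyed_single le_d0 le_t).
    have leK : (2 * imageC * flatC <= K)%N by rewrite leq_addr.
    have leK' := leq_mul leK (leqnn (t ^ 2 * (m ^ 3 * d * L))%N).
    move: energy leK' {leK}; move: K sumX imageC flatC m L => k X I f n l.
    rewrite (_ : 2 * n * (I * f * n ^ 2 * d * t ^ 2 * l) = 2 * I * f * (t ^ 2 * (n ^ 3 * d * l)))%N; last by ring.
    rewrite (_ : t ^ 2 * (4 * n * t + k * (n ^ 3 * d * l)) = 4 * n * t ^ 3 + k * (t ^ 2 * (n ^ 3 * d * l)))%N; last by ring.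
    rewrite (_ : t ^ 2 * t ^ 2 = t ^ 4)%N; last by ring.
    clear; lia.
  have := sum_keyed_blocks g_gt0 le_g3 le_mg le_h0 le_ih le_hg lt_t.
  have leK : (32 * imageC * cubeC <= K)%N by rewrite leq_addl.
  have leK' := leq_mul leK (leqnn (t ^ 2 * (m ^ 3 * d * L))%N).
  move: energy leK' {leK}; move: K sumX imageC cubeC m L => k X I f n l.
  rewrite (_ : 32 * I * f * n ^ 3 * d * t ^ 2 * l = 32 * I * f * (t ^ 2 * (n ^ 3 * d * l)))%N; last by ring.
  rewrite (_ : t ^ 2 * (4 * n * t + k * (n ^ 3 * d * l)) = 4 * n * t ^ 3 + k * (t ^ 2 * (n ^ 3 * d * l)))%N; last by ring.
  rewrite (_ : t ^ 2 * t ^ 2 = t ^ 4)%N; last by ring.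
  clear; lia.
apply: leq_trans core _; rewrite /keysC -/K.
have le_d : (d <= (2 * stepC c * (1 + 2 * imageC) + 4 * headC) * (g + d0))%N.
  by rewrite /d; move: (stepC c) imageC headC => S I H; clear; nia.
move: le_d {le_h0 le_ih le_hg le_d0 energy}; move: (2 * stepC c * _ + _)%N d => D d le_d.
rewrite (_ : K * (m ^ 3 * d * L) = K * m ^ 3 * L * d)%N; last by move: K m L => k n l; ring.
apply: leq_trans (leq_add (leqnn _) (leq_mul (leqnn _) le_d)) _ => {le_d}.
by move: K m L D (g + d0)%N => k n l e G; clear; nia.
Qed.

End SumsetKeys.

(** * Application to subgroups of the units of ['F_p] *)

Lemma cube_root_approx m : (0 < m)%N ->
  exists g, [/\ 0 < g, g ^ 3 <= 8 * m & m <= g ^ 3]%N.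
Proof.
move=> m_gt0; have ex_g : exists g, (m <= g ^ 3)%N.
  by exists m; rewrite -[X in (X <= _)%N]expn1 leq_pexp2l.
case: (ex_minnP ex_g) => -[|g] le_mg min_g; first by move: le_mg; rewrite leqNgt m_gt0.
exists g.+1; split=> //; case: g => [|g] in le_mg min_g *; first by rewrite muln_gt0.
have lt_g : (g.+1 ^ 3 < m)%N.
  by rewrite ltnNge; apply/negP => /min_g; rewrite ltnn.
apply: (@leq_trans (8 * g.+1 ^ 3)); last by rewrite leq_mul2l ltnW.
by rewrite -[8%N]/(2 ^ 3)%N -expnMn leq_exp2r //; lia.
Qed.

Section ResiduesOfSubgroup.
Variables (p : nat) (A : {group {unit 'F_p}}).

Lemma card_residues : #|residues A| = #|A|.
Proof. by rewrite card_imset //; apply: val_inj. Qed.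

(** By Lagrange the subgroup consists of roots of [x ^ t = 1] with [t = #|A|], and there are at most
    [t] of those. *)
Lemma residuesE : residues A = unity_roots 'F_p #|A|.
Proof.
apply/eqP; rewrite eqEcard card_residues card_expr_eq_leq ?cardG_gt0 // andbT.
apply/subsetP => _ /imsetP[u uA ->]; by rewrite inE -FinRing.val_unitX expg_cardG.
Qed.

End ResiduesOfSubgroup.

Lemma sumset_residues_bound (c : nat) : exists K : nat, (0 < K)%N /\
  forall (p : nat) (A : {group {unit 'F_p}}), prime p -> (1 < #|A|)%N ->
  (#|A| ^ 3 <= c * p ^ 2)%N ->
  exists m g : nat, [/\ (0 < m)%N, (0 < g)%N, (g ^ 3 <= 8 * m)%N,
    (m * #|A| <= #|sumset2 (residues A)|)%N &
    (#|A| ^ 2 <= K * (m * #|A| + log2S #|A| * m ^ 3 * (g + (#|A| ^ 2 %/ p).+1)))%N].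
Proof.
exists (keysC c (2 + 2 * c)); split; first by rewrite /keysC.
move=> p A pr_p t_gt1 t_small; have p_gt0 := prime_gt0 pr_p.
set d0 := (_ %/ p).+1.
have t_d0 : (#|A| ^ 2 <= p * d0)%N by rewrite mulnC ltnW // ltn_ceil.
(* From [p * d0 <= p + t ^ 2] one gets [(p * d0) ^ 2 <= 2 * p ^ 2 + 2 * t ^ 4], and
   [t ^ 4 <= c * p ^ 2 * t]. *)
have d0_small : (d0 ^ 2 <= (2 + 2 * c) * #|A|)%N.
  have p2_gt0 : (0 < p ^ 2)%N by rewrite expn_gt0 p_gt0.
  rewrite -(leq_pmul2l p2_gt0) -expnMn.
  have le_pd : (p * d0 <= p + #|A| ^ 2)%N.
    by rewrite mulnS leq_add2l mulnC leq_trunc_div.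
  have : ((p * d0) ^ 2 <= (p + #|A| ^ 2) ^ 2)%N by rewrite leq_exp2r.
  have : (#|A| ^ 4 <= c * p ^ 2 * #|A|)%N by rewrite expnSr leq_mul2r t_small orbT.
  rewrite (expnM _ 2 2) sqrnD; move: (nat_Cauchy p (#|A| ^ 2)).1 t_gt1.
  move: (p * d0)%N (#|A| ^ 2)%N #|A| (p ^ 2)%N => P T t q; clear; nia.
have charFp := pchar_Fp pr_p.
have cardA : #|unity_roots 'F_p #|A| | = #|A| by rewrite -residuesE card_residues.
have m_gt0 := card_sum_keys_gt0 cardA t_gt1.
have [g [g_gt0 le_g3 le_mg]] := cube_root_approx m_gt0.
exists #|sum_keys 'F_p #|A| |, g; split=> //.
  by rewrite residuesE; apply: card_sumset_geq; rewrite // ltnW.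
exact: (@sum_keys_bound _ p #|A| c (2 + 2 * c) d0).
Qed.

(** * Passage to real logarithms and the two ranges of [#|A|] *)

Section Logarithms.
Variable R : realType.

Lemma ln2_geq : 2^-1 <= ln 2 :> R.
Proof.
have : ln (1 + - 2^-1) <= - 2^-1 :> R by apply: le_ln1Dx; lra.
have -> : 1 + - 2^-1 = 2^-1 :> R by lra.
by rewrite lnV ?posrE // lerN2.
Qed.

Lemma log2S_leq_ln (t : nat) : (1 < t)%N -> (log2S t)%:R <= 4 * ln t%:R :> R.
Proof.
move=> t_gt1; have ln2 := ln2_geq; have t_gt0 := ltnW t_gt1.
have le_2t : ln 2 <= ln t%:R :> R by rewrite ler_ln ?posrE ?ltr0n ?ler_nat.
have le_log : (trunc_log 2 t)%:R * ln 2 <= ln t%:R :> R.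
  rewrite mulr_natl -lnXn // -natrX ler_ln ?posrE ?ltr0n ?expn_gt0 //.
  by rewrite ler_nat trunc_logP.
have k_ge0 : 0 <= (trunc_log 2 t)%:R :> R by rewrite ler0n.
by rewrite /log2S -natr1; nra.
Qed.

(** One of the three terms on the right must be large. If all alternatives fail, the terms with
    [m * a], [g + 1] and [a ^+ 2 / q] are at most 1/48, 1/3 and 1/12 of [a ^+ 2], less than the
    whole. The exponent 10/3 comes from [m ^+ 3 * g] with [g] at most twice the cube root of [m]. *)
Lemma log_trichotomy (K a m g l ell q : R) :
  1 <= K -> 0 < a -> 0 < m -> 1 <= g -> 0 < ell -> 0 < q -> 0 <= l ->
  l <= 4 * ell -> g ^+ 3 <= 8 * m ->
  a ^+ 2 <= K * (m * a + l * m ^+ 3 * (g + (a ^+ 2 / q + 1))) ->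
  [\/ ln a <= ln (48 * K) + ln m,
      2 * ln a <= ln (48 * K) + ln ell + 10 / 3 * ln m |
      ln q <= ln (48 * K) + ln ell + 3 * ln m].
Proof.
move=> K1 a0 m0 g1 ell0 q0 l0 le_l le_g le_a.
have Kp : 0 < K by lra.
have K0 : 0 < 48 * K by lra.
pose y := expR (ln m / 3).
have y0 : 0 < y by apply: expR_gt0.
have lny : ln y = ln m / 3 by rewrite expRK.
have yE : m = y ^+ 3.
  by rewrite /y -expRM_natl mulr_natl -mulr_natr divfK ?lnK ?posrE // pnatr_eq0.
have le_gy : g <= 2 * y.
  by rewrite -(@ler_pXn2r _ 3) ?nnegrE //; try lra; rewrite exprMn -yE; lra.
have [le_i|lt_i] := leP a (48 * K * m).
  by apply: Or31; rewrite -lnM ?posrE // ler_ln ?posrE // mulr_gt0.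
have [le_ii|lt_ii] := leP (a ^+ 2) (48 * K * ell * y ^+ 10).
  apply: Or32.
  have : ln (a ^+ 2) <= ln (48 * K * ell * y ^+ 10).
    by rewrite ler_ln ?posrE ?exprn_gt0 // !mulr_gt0 ?exprn_gt0.
  rewrite lnXn // [X in _ <= X]lnM ?posrE ?mulr_gt0 ?exprn_gt0 //.
  rewrite [ln (48 * K * ell)]lnM ?posrE // lnXn // lny.
  by rewrite -(mulr_natl _ 2) -(mulr_natl _ 10); lra.
have [le_iii|lt_iii] := leP q (48 * K * ell * m ^+ 3).
  apply: Or33.
  have : ln q <= ln (48 * K * ell * m ^+ 3).
    by rewrite ler_ln ?posrE // !mulr_gt0 ?exprn_gt0.
  rewrite [X in _ <= X]lnM ?posrE ?mulr_gt0 ?exprn_gt0 //.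
  rewrite [ln (48 * K * ell)]lnM ?posrE // lnXn //.
  by rewrite -(mulr_natl _ 3); lra.
have m3 : 0 < m ^+ 3 by rewrite exprn_gt0.
have a2 : 0 < a ^+ 2 by rewrite exprn_gt0.
have b1 : K * (m * a) < a ^+ 2 / 48.
  by rewrite (expr2 a); have := ltr_pM2r a0 (48 * K * m) a; rewrite lt_i; lra.
have b2 : K * (l * m ^+ 3 * (g + 1)) <= a ^+ 2 / 3.
  have e1 : l * m ^+ 3 * (g + 1) <= 4 * ell * m ^+ 3 * (4 * y).
    apply: ler_pM; [by rewrite mulr_ge0 // ltW| lra | | lra].
    by rewrite ler_pM2r.
  have e2 : m ^+ 3 * y = y ^+ 10 by rewrite yE -exprM -exprSr.
  have := ler_wpM2l (ltW Kp) e1; have -> : K * (4 * ell * m ^+ 3 * (4 * y)) = 16 * K * ell * (m ^+ 3 * y) by ring.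
  by rewrite e2; lra.
have b3 : K * (l * m ^+ 3 * (a ^+ 2 / q)) <= a ^+ 2 / 12.
  rewrite !mulrA ler_pdivrMr //.
  have : K * l * m ^+ 3 <= q / 12.
    have : l * m ^+ 3 <= 4 * ell * m ^+ 3 by rewrite ler_pM2r.
    by move=> /(ler_wpM2l (ltW Kp)); lra.
  by move=> /(ler_wpM2r (ltW a2)); lra.
exfalso; move: le_a; rewrite leNgt => /negP; apply.
have -> : K * (m * a + l * m ^+ 3 * (g + (a ^+ 2 / q + 1)))
  = K * (m * a) + K * (l * m ^+ 3 * (g + 1)) + K * (l * m ^+ 3 * (a ^+ 2 / q)) by ring.
lra.
Qed.

End Logarithms.

(* After taking logarithms each of the three alternatives of [log_trichotomy] makes both bounds
   linear inequalities in [ln a], [ln (ln a)], [ln q] and [ln m]. *)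
Theorem theorem10 (R : realType) (C0 C1 C2 : R)
    (hC0 : 0 < C0) (hC1 : 0 < C1) (hC2 : 0 < C2) :
  exists2 C : R, 0 < C &
    forall (p : nat) (A : {group {unit 'F_p}}),
      prime p ->
      let a : R := #|A|%:R in
      let q : R := p%:R in
      let s : R := #|sumset2 (residues A)|%:R in
      ll_with C0 a (q `^ (2 / 3)) ->
      (ll_with C1 a (q `^ (5 / 9) * ln a `^ (- (1 / 18))) ->
        ll_with C (a `^ (8 / 5) * ln a `^ (- (3 / 10))) s) /\
      (ll_with C2 (q `^ (5 / 9) * ln a `^ (- (1 / 18))) a ->
        ll_with C (a * q `^ (1 / 3) * ln a `^ (- (1 / 3))) s).
Proof.
pose c := (Num.truncn (C0 ^+ 3)).+1.
have [K [K_gt0 bound]] := sumset_residues_bound c.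
pose k : R := `|ln C1| + `|ln C2| + ln (48 * K%:R) + 10.
exists (expR k); first exact: expR_gt0.
move=> p A pr_p a q s; rewrite /ll_with => le_a0.
have p_gt0 := prime_gt0 pr_p.
have q0 : 0 < q by rewrite ltr0n.
have s0 : 0 <= s by rewrite ler0n.
(* For the trivial subgroup [ln a = 0], and a power of 0 with nonzero exponent is 0 even when the
   exponent is negative, so both lower bounds are 0. *)
have [t_le1|t_gt1] := leqP #|A| 1.
  have a1 : a = 1.
    by rewrite /a (_ : #|A| = 1%N) //; apply/eqP; rewrite eqn_leq t_le1 cardG_gt0.
  rewrite a1 ln1 !powR0 ?mulr0; try by rewrite oppr_eq0; lra.
  by split=> _; rewrite mulr_ge0 // expR_ge0.
have a0 : 0 < a by rewrite ltr0n cardG_gt0.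
have t_small : (#|A| ^ 3 <= c * p ^ 2)%N.
  have le3 : a ^+ 3 <= C0 ^+ 3 * q ^+ 2.
    have : a ^+ 3 <= (C0 * q `^ (2 / 3)) ^+ 3.
      by rewrite ler_pXn2r ?nnegrE ?mulr_ge0 ?powR_ge0 // ltW.
    rewrite exprMn; suff -> : (q `^ (2 / 3)) ^+ 3 = q ^+ 2 by [].
    rewrite -powR_mulrn ?powR_ge0 // -powRrM.
    have -> : 2 / 3 * 3%:R = 2%:R :> R by lra.
    by rewrite powR_mulrn // ltW.
  rewrite -(ler_nat R) natrM !natrX; apply: le_trans le3 _.
  rewrite ler_pM2r ?exprn_gt0 //; apply/ltW.
  by rewrite truncnS_gt.
have [m [g [m_gt0 g_gt0 le_g le_s le_a]]] := bound p A pr_p t_gt1 t_small.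
have ell0 : 0 < ln a by rewrite ln_gt0 // ltr1n.
have m0 : 0 < m%:R :> R by rewrite ltr0n.
have K1 : 1 <= K%:R :> R by rewrite ler1n.
have g1 : 1 <= g%:R :> R by rewrite ler1n.
have l0 : 0 <= (log2S #|A|)%:R :> R by rewrite ler0n.
have le_g' : g%:R ^+ 3 <= 8 * m%:R :> R.
  by rewrite -natrX -natrM ler_nat.
have le_a' : a ^+ 2 <= K%:R * (m%:R * a + (log2S #|A|)%:R * m%:R ^+ 3
    * (g%:R + (a ^+ 2 / q + 1))).
  apply: (@le_trans _ _ (K * (m * #|A| + log2S #|A| * m ^ 3 * (g + (#|A| ^ 2 %/ p).+1)))%:R).
    by rewrite -natrX ler_nat.
  rewrite natrM natrD [(m * #|A|)%:R]natrM [(_ * (g + _))%:R]natrM natrD -natr1.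
  rewrite [(log2S _ * _)%:R]natrM natrX.
  rewrite ler_pM2l ?ltr0n // lerD2l ler_wpM2l ?mulr_ge0 ?exprn_ge0 ?ler0n //.
  rewrite lerD2l lerD2r ler_pdivlMr // -natrX -natrM ler_nat; exact: leq_trunc_div.
have tri := log_trichotomy K1 a0 m0 g1 ell0 q0 l0 (log2S_leq_ln R t_gt1) le_g' le_a'.
have sE : expR (ln m%:R + ln a) <= s.
  by rewrite expRD !lnK ?posrE // -natrM ler_nat.
have powE (x r : R) : 0 < x -> x `^ r = expR (r * ln x).
  by move=> x0; rewrite /powR gt_eqF.
have aE : a = expR (ln a) by rewrite lnK ?posrE.
have C1E : C1 = expR (ln C1) by rewrite lnK ?posrE.
have C2E : C2 = expR (ln C2) by rewrite lnK ?posrE.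
have tau0 : 0 <= ln a by apply: ltW.
(* [ln (ln a)] can be negative for small [a]; this lower bound lets the summand 10 of [k] absorb
   it. *)
have lam1 : -1 <= ln (ln a).
  have le_2 : 2^-1 <= ln a.
    apply: le_trans (ln2_geq R) _; rewrite ler_ln ?posrE // ler_nat //.
  apply: (@le_trans _ _ (ln (2^-1 : R))); last by rewrite ler_ln ?posrE ?invr_gt0.
  rewrite lnV ?posrE // lerN2.
  have -> : 2 = 1 + 1 :> R by lra.
  by apply: le_ln1Dx; lra.
have xi0 : 0 <= ln m%:R :> R by rewrite ln_ge0 // ler1n.
have kap0 : 0 <= ln (48 * K%:R) :> R by rewrite ln_ge0; lra.
have [abs1 abs1'] : ln C1 <= `|ln C1| /\ 0 <= `|ln C1| by rewrite ler_norm normr_ge0.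
have [abs2 abs2'] : ln C2 <= `|ln C2| /\ 0 <= `|ln C2| by rewrite ler_norm normr_ge0.
have thrE : q `^ (5 / 9) * ln a `^ (- (1 / 18)) = expR (5 / 9 * ln q - 1 / 18 * ln (ln a)).
  by rewrite !powE // -expRD mulNr.
rewrite thrE; split=> hyp; apply: le_trans (ler_wpM2l (expR_ge0 k) sE).
  have {}hyp : expR (ln a) <= expR (ln C1 + (5 / 9 * ln q - 1 / 18 * ln (ln a))).
    by rewrite expRD -aE -C1E.
  move: hyp; rewrite !powE // -!expRD !ler_expR /k => hyp.
  (* The second alternative gives the exponents 8/5 and 3/10 directly; the third gives them after
     [ln q] is bounded below through the threshold, since [9/5 * 1/3 = 3/5] and
     [1/3 - 1/30 = 3/10]. *)
  by case: tri; lra.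
have {}hyp : expR (5 / 9 * ln q - 1 / 18 * ln (ln a)) <= expR (ln C2 + ln a).
  by rewrite [leRHS]expRD -aE -C2E.
have -> : a * q `^ (1 / 3) * ln a `^ (- (1 / 3))
  = expR (ln a + 1 / 3 * ln q - 1 / 3 * ln (ln a)).
  by rewrite !powE // !expRD -aE mulNr.
move: hyp; rewrite -expRD !ler_expR /k => hyp.
(* Here the third alternative is the direct one, and the second is converted through the threshold:
   the two bounds agree there. *)
by case: tri; lra.
Qed.
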